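(* Consider the jump-diffusion process $X$ described in the context, with coefficients $\gamma,\sigma,\lambda$ and jump density $f$ satisfying the conditions listed there. For $t\ge 0$, $h>0$, $w>0$ and $B\ge 0$ let $$L_{t,h}(B;w):=\mathbb{P}\left(|X_{t+h}-X_t|>B,\;N_{t+h}-N_t=0\right)+w\,\mathbb{P}\left(|X_{t+h}-X_t|\le B,\;N_{t+h}-N_t\neq 0\right).$$ Then, for any fixed $T>0$, there exists $h_0:=h_0(T)>0$ such that, for all $t\in[0,T]$, $h\in(0,h_0]$ and $w>0$, the function $B\mapsto L_{t,h}(B;w)$ is quasi-convex on $[0,\infty)$ and possesses a unique global minimum point $B^*_{t,h}$.
   Context: Model: $X_t=X^c_t+J_t$, $X^c_t=\int_0^t\gamma_u\,du+\int_0^t\sigma_u\,dW_u$, $J_t=\sum_{j=1}^{N_t}\zeta_j$, where $W$ is a Wiener process, $N$ is a non-homogeneous Poisson process with intensity function $\{\lambda_t\}_{t\ge0}$, and $\{\zeta_j\}_{j\ge1}$ are i.i.d. with density $f$; $W$, $N$ and $\{\zeta_j\}$ are independent (in particular $X^c$ and $J$ are independent). Conditions on the coefficients: $\gamma:[0,\infty)\to\mathbb{R}$, $\sigma:[0,\infty)\to\mathbb{R}^+$, $\lambda:[0,\infty)\to\mathbb{R}^+$ are deterministic functions (such that the integrals above are well defined) and, for any fixed $t>0$, $0<\inf_{0\le s\le t}\sigma_s\le\sup_{0\le s\le t}\sigma_s<\infty$, $0<\inf_{0\le s\le t}\gamma_s\le\sup_{0\le s\le t}\gamma_s<\infty$,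 $0<\inf_{0\le s\le t}\lambda_s\le\sup_{0\le s\le t}\lambda_s<\infty$. Moreover $t\mapsto\sigma_t$ is continuous. Conditions on the jump density: $f(x)=p f_+(x)\mathbf{1}_{[x\ge0]}+q f_-(x)\mathbf{1}_{[x<0]}$ with $p\in[0,1]$, $q=1-p$, where $f_+:[0,\infty)\to[0,\infty)$ and $f_-:(-\infty,0]\to[0,\infty)$ are bounded, $\int_0^\infty f_+(x)dx=\int_{-\infty}^0 f_-(x)dx=1$, and $f_\pm(0)=\lim_{x\to0^\pm}f_\pm(x)\in(0,\infty)$. In addition, $f_+\in C^1([0,b))$ and $f_-\in C^1((a,0])$ for some $a\in(-\infty,0)$, $b\in(0,\infty)$, and the limits $f'_\pm(0):=\lim_{x\to0^\pm}f'_\pm(x)$ exist. A function $g$ on a convex set $D\subset\mathbb{R}$ is quasi-convex if $g(\theta x+(1-\theta)y)\le\max\{g(x),g(y)\}$ for all $x,y\in D$, $\theta\in[0,1]$. *)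

(* Defs.v *)
From HB Require Import structures.
From mathcomp Require Import all_boot all_order all_algebra.
From mathcomp Require Import all_classical all_reals all_analysis.

Set Implicit Arguments.
Unset Strict Implicit.
Unset Printing Implicit Defensive.

Import Order.TTheory GRing.Theory Num.Theory.
Import numFieldNormedType.Exports.

Local Open Scope classical_set_scope.
Local Open Scope ring_scope.

Section real_functions.
Context {R : realType}.
Implicit Types (D : set R) (f g : R -> R).

Definition quasi_convex_on D g : Prop :=
  forall x y theta, D x -> D y -> 0 <= theta <= 1 ->
    g (theta * x + (1 - theta) * y) <= Num.max (g x) (g y).

Definition global_min_on D g (x : R) : Prop :=
  D x /\ forall y, D y -> g x <= g y.

(* The derivative is taken within D, hence it is one-sided at an end point of
   the interval D that belongs to D. *)
Definition C1_on D f : Prop :=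
  exists2 df : R -> R, {within D, continuous df} &
    forall x, D x ->
      (f y - f x) / (y - x) @[y --> within D x^'] --> df x.

(* 0 < inf_{0 <= s <= t} g_s <= sup_{0 <= s <= t} g_s < oo for all t > 0, with
   the infimum and the supremum taken in the extended reals. *)
Definition locally_bounded_away g : Prop :=
  forall t : R, 0 < t ->
    let values := [set (g s)%:E | s in `[0, t]] in
    (0 < ereal_inf values <= ereal_sup values)%E /\
    (ereal_sup values < +oo)%E.

Definition locally_integrable_on_time g : Prop :=
  forall t : R, 0 < t ->
    (@lebesgue_measure R).-integrable `[0, t] (EFin \o g).

Record coefficient_conditions (gamma sigma lambda : R -> R) : Prop := {
  gamma_integrable : locally_integrable_on_time gamma ;
  lambda_integrable : locally_integrable_on_time lambda ;
  sigma_continuous : {within `[0, +oo[, continuous sigma} ;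
  gamma_bounded_away : locally_bounded_away gamma ;
  sigma_bounded_away : locally_bounded_away sigma ;
  lambda_bounded_away : locally_bounded_away lambda }.

(* fp and fm are total functions, but only fp on [0, +oo[ and fm on ]-oo, 0]
   are constrained and used. *)
Definition jump_density (p : R) (fp fm : R -> R) (x : R) : R :=
  p * fp x * \1_`[0, +oo[ x + (1 - p) * fm x * \1_`]-oo, 0[ x.

Record jump_density_conditions (p : R) (fp fm : R -> R) : Prop := {
  p_itv : 0 <= p <= 1 ;
  fp_ge0 : forall x : R, 0 <= x -> 0 <= fp x ;
  fm_ge0 : forall x : R, x <= 0 -> 0 <= fm x ;
  fp_bounded : exists M : R, forall x : R, 0 <= x -> fp x <= M ;
  fm_bounded : exists M : R, forall x : R, x <= 0 -> fm x <= M ;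
  fp_measurable : measurable_fun (`[0, +oo[ : set R) fp ;
  fm_measurable : measurable_fun (`]-oo, 0] : set R) fm ;
  fp_mass : (\int[lebesgue_measure]_(x in `[0%R, +oo[) (fp x)%:E = 1)%E ;
  fm_mass : (\int[lebesgue_measure]_(x in `]-oo, 0%R]) (fm x)%:E = 1)%E ;
  fp_right_continuous0 : fp x @[x --> 0^'+] --> fp 0 ;
  fm_left_continuous0 : fm x @[x --> 0^'-] --> fm 0 ;
  fp0_gt0 : 0 < fp 0 ;
  fm0_gt0 : 0 < fm 0 ;
  fp_C1 : exists2 b : R, 0 < b & C1_on `[0, b[ fp ;
  fm_C1 : exists2 a : R, a < 0 & C1_on `]a, 0] fm ;
  fp_derive_cvg0 : cvg (derive1 fp x @[x --> 0^'+]) ;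
  fm_derive_cvg0 : cvg (derive1 fm x @[x --> 0^'-]) }.

End real_functions.

Section processes.
Context {d : measure_display} {Omega : measurableType d} {R : realType}.
Variable P : probability Omega R.

Definition mutually_independent (I : eqType) (F : I -> set (set Omega)) : Prop :=
  forall (J : seq I) (A : I -> set Omega), uniq J ->
    (forall i, i \in J -> F i (A i)) ->
    P (\bigcap_(i in [set` J]) A i) = (\prod_(i <- J) P (A i))%E.

Definition sigma_algebra_of d' (E : measurableType d') (Y : Omega -> E) :
    set (set Omega) :=
  preimage_set_system setT Y measurable.

Definition sigma_algebra_of_family (I : Type) d' (E : measurableType d')
    (D : set I) (Y : I -> Omega -> E) : set (set Omega) :=
  <<s \bigcup_(i in D) sigma_algebra_of (Y i) >>.

Definition independent_increments (Y : R -> Omega -> R) : Prop :=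
  forall (n : nat) (s : nat -> R),
    0 <= s 0%N -> (forall i, (i < n)%N -> s i <= s i.+1) ->
    mutually_independent (fun i : 'I_n =>
      sigma_algebra_of (fun om => Y (s i.+1) om - Y (s i) om)).

Record wiener_process (W : R -> {RV P >-> R}) : Prop := {
  wiener0 : {ae P, forall om, W 0 om = 0} ;
  wiener_increments_indep : independent_increments W ;
  wiener_increments_normal : forall s t : R, 0 <= s -> s < t ->
    forall A, measurable A ->
      P ((fun om => W t om - W s om) @^-1` A) =
      normal_prob 0 (Num.sqrt (t - s)) A ;
  wiener_continuous :
    {ae P, forall om, {within `[0, +oo[, continuous (W ^~ om)}} }.

Record poisson_process (lambda : R -> R) (N : R -> {RV P >-> nat}) : Prop := {
  poisson0 : {ae P, forall om, N 0 om = 0%N} ;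
  poisson_increments_indep : independent_increments (fun t om => (N t om)%:R) ;
  poisson_increments_law : forall s t : R, 0 <= s -> s < t -> forall k : nat,
    P [set om | (N t om)%:R - (N s om)%:R = k%:R :> R] =
    (poisson_pmf (\int[lebesgue_measure]_(u in `[s, t]) lambda u) k)%:E ;
  poisson_nondecreasing :
    {ae P, forall om (s t : R), 0 <= s -> s <= t -> (N s om <= N t om)%N} ;
  poisson_right_continuous : {ae P, forall om (t : R), 0 <= t ->
    ((N s om)%:R : R) @[s --> t^'+] --> ((N t om)%:R : R)} }.

Record iid_with_density (f : R -> R) (zeta : nat -> {RV P >-> R}) : Prop := {
  iid_indep : mutually_independent (fun j => sigma_algebra_of (zeta j)) ;
  iid_density : forall j A, measurable A ->
    P (zeta j @^-1` A) = (\int[lebesgue_measure]_(x in A) (f x)%:E)%E }.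

Definition independent_drivers (W : R -> {RV P >-> R})
    (N : R -> {RV P >-> nat}) (zeta : nat -> {RV P >-> R}) : Prop :=
  mutually_independent (fun i : 'I_3 => nth set0
    [:: sigma_algebra_of_family `[0, +oo[ W ;
        sigma_algebra_of_family `[0, +oo[ N ;
        sigma_algebra_of_family [set: nat] zeta] i).

(* The step function sum_{i < m} c_i 1_{]s_i, s_{i+1}]} and its integral
   against W. *)
Definition step_function (m : nat) (s c : nat -> R) (u : R) : R :=
  \sum_(i < m) c i * \1_`]s i, s i.+1] u.

Definition step_integral (W : R -> Omega -> R) (m : nat) (s c : nat -> R)
    (om : Omega) : R :=
  \sum_(i < m) c i * (W (s i.+1) om - W (s i) om).

(* Y is (a version of) the Wiener integral of g over [0, t]: the L^2(P)-limit of
   the integrals of step functions converging to g in L^2([0, t]). *)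
Definition wiener_integral (W : R -> Omega -> R) (g : R -> R) (t : R)
    (Y : Omega -> R) : Prop :=
  exists (m : nat -> nat) (s c : nat -> nat -> R),
    [/\ forall n, [/\ s n 0%N = 0, s n (m n) = t &
          forall i, (i < m n)%N -> s n i <= s n i.+1],
        (\int[lebesgue_measure]_(u in `[0%R, t])
           ((step_function (m n) (s n) (c n) u - g u) ^+ 2)%:E)%E
          @[n --> \oo] --> 0%E &
        ('E_P[(fun om => (step_integral W (m n) (s n) (c n) om - Y om) ^+ 2)%R])%E
          @[n --> \oo] --> 0%E].

(* S is the continuous process t |-> int_0^t g_u dW_u. *)
Record wiener_integral_process (W : R -> {RV P >-> R}) (g : R -> R)
    (S : R -> {RV P >-> R}) : Prop := {
  wiener_integral_process_at : forall t : R, 0 <= t -> wiener_integral W g t (S t) ;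
  wiener_integral_process_continuous :
    {ae P, forall om, {within `[0, +oo[, continuous (S ^~ om)}} }.

(* zeta is indexed from 0, so the first N_t jumps are zeta_0, ..., zeta_{N_t-1}. *)
Definition jump_part (N : R -> Omega -> nat) (zeta : nat -> Omega -> R)
    (t : R) (om : Omega) : R :=
  \sum_(j < N t om) zeta j om.

Definition continuous_part (gamma : R -> R) (S : R -> Omega -> R)
    (t : R) (om : Omega) : R :=
  (\int[lebesgue_measure]_(u in `[0, t]) gamma u) + S t om.

Definition jump_diffusion (gamma : R -> R) (S : R -> Omega -> R)
    (N : R -> Omega -> nat) (zeta : nat -> Omega -> R)
    (t : R) (om : Omega) : R :=
  continuous_part gamma S t om + jump_part N zeta t om.

(* N_{t+h} - N_t is computed in R: subtraction on nat is truncated. *)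
Definition threshold_loss (X : R -> Omega -> R) (N : R -> Omega -> nat)
    (t h w B : R) : R :=
  fine (P [set om | `|X (t + h) om - X t om| > B /\
                    (N (t + h) om)%:R - (N t om)%:R = 0 :> R]) +
  w * fine (P [set om | `|X (t + h) om - X t om| <= B /\
                    (N (t + h) om)%:R - (N t om)%:R <> 0 :> R]).

End processes.

(* Main.v *)
Require Import Defs.
From HB Require Import structures.
From mathcomp Require Import all_boot all_order all_algebra.
From mathcomp Require Import all_classical all_reals all_analysis.
From mathcomp Require Import measurable_realfun.
From mathcomp Require Import ring lra.

(* Write D for the increment of the diffusive part minus its drift, a centred
   normal variable of variance v = s^2, m for the drift and nu for the law of the
   sum of the jumps in ]t, t + h] on the event that there is at least one. As D
   is independent of the jumps, L(B) is, up to a constant, the integral over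
   ]0, B] of w g_J - q g_D, where g_D is the density of |m + D|, g_J the mixture
   over nu(dy) of the densities of |m + y + D|, and q the probability of no jump.
   It is enough that g_J / g_D be strictly increasing and unbounded.

   The contribution of a = m + y to g_J / g_D is, up to a positive constant,
   exp (- a^2 / 2v) cosh (a b / v) / cosh (m b / v), which is increasing in b
   unless |a| < m. For small h, m = O(h) is much smaller than s ~ sqrt h, and
   the decrease due to |a| < m, of order (m / s)^2 P(N_{t+h} - N_t <> 0) = O(h^2),
   is dominated by the increase due to s <= |a| <= 2 s, of order at least
   s P(N_{t+h} - N_t = 1), because f is bounded below on one side of 0. *)

Set Implicit Arguments.
Unset Strict Implicit.
Unset Printing Implicit Defensive.

Import Order.TTheory GRing.Theory Num.Theory.
Import numFieldNormedType.Exports.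

Local Open Scope classical_set_scope.
Local Open Scope ring_scope.

(** * Image measures and affine changes of variables *)

(** The stochastic integral is given only as an L^2 limit of step integrals, and this version is not
    known to be measurable for the sigma-algebra of W. So neither its normal law nor its
    independence of the jumps can be read off directly. Both are obtained at once, by carrying
    through the limit the identity P(Z_n in A, E) = gauss(v_n)(A) P(E), where E is any event
    independent of W. The increment over ]t, t + h] is approached by the difference of two step
    integrals on unrelated partitions; these must be brought to a common partition before the
    difference becomes a sum of independent terms.

    Time enters the comparison only through bounds of the coefficients on [0, T + 1], and neither w
    nor the probability of no jump enters the monotonicity of the ratio, which is why one h_0 serves
    all t in [0, T] and all w. Comparing the two orders in h also requires P(N_{t+h} - N_t <> 0) to
    be at most a constant times P(N_{t+h} - N_t = 1); the bound on the intensity provides this. *)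

Definition image_measure {R : realType} {d d1 : measure_display}
    {Om : measurableType d} {T1 : measurableType d1}
    (P : set Om -> \bar R) (E : set Om) (X : Om -> T1)
    (mE : measurable E) (mX : measurable_fun [set: Om] X) (A : set T1) : \bar R :=
  P (X @^-1` A `&` E).

Section image_measure.
Context {R : realType} {d d1 : measure_display} {Om : measurableType d}
  {T1 : measurableType d1}.
Variables (P : {measure set Om -> \bar R}) (E : set Om) (X : Om -> T1).
Hypotheses (mE : measurable E) (mX : measurable_fun [set: Om] X).
Local Notation im := (image_measure P mE mX).
Local Open Scope ereal_scope.

Let im0 : im set0 = 0.
Proof. by rewrite /image_measure preimage_set0 set0I measure0. Qed.

Let im_ge0 A : 0 <= im A.
Proof. exact: (measure_ge0 (mrestr P mE)). Qed.

Let im_sigma_additive : semi_sigma_additive im.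
Proof.
have mXA A : measurable A -> measurable (X @^-1` A).
  by move=> mA; rewrite -[X in measurable X]setTI; exact: mX.
move=> F mF tF mUF; rewrite /image_measure preimage_bigcup.
apply: (@measure_semi_sigma_additive _ _ _ (mrestr P mE)).
- by move=> n; exact: mXA.
- apply/trivIsetP => /= i j _ _ ij; rewrite -preimage_setI.
  by move/trivIsetP : tF => /(_ _ _ _ _ ij) ->//; rewrite preimage_set0.
- by rewrite -preimage_bigcup; exact: mXA.
Qed.

HB.instance Definition _ := isMeasure.Build _ _ _ im
  im0 im_ge0 im_sigma_additive.

End image_measure.

Section finite_image_measure.
Context {R : realType} {d d1 : measure_display} {Om : measurableType d}
  {T1 : measurableType d1}.
Variables (P : {finite_measure set Om -> \bar R}) (E : set Om) (X : Om -> T1).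
Hypotheses (mE : measurable E) (mX : measurable_fun [set: Om] X).
Local Notation im := (image_measure P mE mX).

Let im_fin : fin_num_fun im.
Proof.
move=> A mA; apply: fin_num_measure.
by apply: measurableI => //; rewrite -[X in measurable X]setTI; exact: mX.
Qed.

HB.instance Definition _ := Measure_isFinite.Build _ _ _ im im_fin.

End finite_image_measure.

Lemma ge0_integral_image_measure {R : realType} {d d1 : measure_display}
    {Om : measurableType d} {T1 : measurableType d1}
    (P : {measure set Om -> \bar R}) (X : Om -> T1)
    (mX : measurable_fun [set: Om] X) (A : set T1) (f : T1 -> \bar R) :
  measurable A -> measurable_fun A f -> (forall x, (0 <= f x)%E) ->
  (\int[image_measure P measurableT mX]_(x in A) f x =
   \int[P]_(om in X @^-1` A) f (X om))%E.
Proof.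
move=> mA mf f0.
rewrite -[RHS](ge0_integral_pushforward mX P mA mf (fun y _ => f0 y)).
by congr (integral _ A f); apply/funext => B; rewrite /image_measure setIT.
Qed.

Section image_measures.
Context {R : realType} {d : measure_display} {Om : measurableType d}.
Local Open Scope ereal_scope.

(** As a function of C the left side is the law of (X, Y) on E, and a measure that factorises on
    rectangles is the product measure. The event E covers three situations at once: E full for the
    convolution of normal laws, E an event on later increments of W, and E the event that a jump
    occurs. On the last two the laws have mass possibly below 1, hence the finite measures. *)
Lemma joint_law_of_rectangles (P : {finite_measure set Om -> \bar R})
    d1 (T1 : measurableType d1) d2 (T2 : measurableType d2)
    (m1 : {finite_measure set T1 -> \bar R})
    (m2 : {finite_measure set T2 -> \bar R})
    (E : set Om) (X : Om -> T1) (Y : Om -> T2) :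
  measurable E -> measurable_fun [set: Om] X -> measurable_fun [set: Om] Y ->
  (forall A B, measurable A -> measurable B ->
     P ((X @^-1` A `&` Y @^-1` B) `&` E) = m1 A * m2 B) ->
  forall C : set (T1 * T2), measurable C ->
    P ([set om | C (X om, Y om)] `&` E) = \int[m1]_x m2 (xsection C x).
Proof.
move=> mE mX mY H C mC.
have mXY : measurable_fun [set: Om] (fun om => (X om, Y om)).
  exact: measurable_fun_pair.
rewrite -[LHS]/(image_measure P mE mXY C).
by rewrite -(@product_measure_unique _ _ _ _ R m1 m2)// => A B mA mB; rewrite -H.
Qed.

End image_measures.

Section affine.
Context {R : realType}.
Local Notation mu := (@lebesgue_measure R).

(** The right side is a measure in A that gives each interval ]a, b] its length, and Lebesgue
    measure is the only such measure. For negative c the preimage of ]a, b] is closed on the left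
    and open on the right, hence the two cases. *)
Lemma lebesgue_measure_affine (c e : R) (A : set R) : c != 0 -> measurable A ->
  mu A = (`|c|%:E * mu ((fun x => (c * x + e)%R) @^-1` A))%E.
Proof.
move=> c0.
have mf : measurable_fun [set: R] (fun x : R => c * x + e).
  by apply: measurable_funD => //; exact: measurable_funM.
move=> mA; pose m1 : {measure set (measurableTypeR R) -> \bar R} :=
  mscale (NngNum (normr_ge0 c))
    (@image_measure _ _ _ _ (measurableTypeR R) mu _ _ measurableT mf).
rewrite (@lebesgue_measure_unique _ m1)//; first by rewrite /m1 /= /mscale/= /image_measure setIT.
move=> _ [[a b]] _ <-; rewrite /m1 /= /mscale/= /image_measure setIT.
have [cgt|clt] : 0 < c \/ c < 0.
  by case: (ltgtP c 0) c0 => // *; [right|left].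
- rewrite [X in (_ * mu X)%E](_ : _ = `](a - e) / c, (b - e) / c]%classic); last first.
    apply/seteqP; split => x /=; rewrite !in_itv/= ltr_pdivrMr// ler_pdivlMr//;
      by rewrite ltrBlDr lerBrDr mulrC.
  rewrite !lebesgue_measure_itv/= !lte_fin ltr_pM2r ?invr_gt0//.
  rewrite ltrD2r; case: ifPn => ab; last by rewrite mule0.
  rewrite -!EFinB -EFinM; congr EFin; rewrite gtr0_norm//; field.
  by rewrite gt_eqF.
- rewrite [X in (_ * mu X)%E](_ : _ = `[(b - e) / c, (a - e) / c[%classic); last first.
    apply/seteqP; split => x /=; rewrite !in_itv/= ltr_ndivlMr// ler_ndivrMr//;
      by rewrite ltrBlDr lerBrDr mulrC andbC.
  rewrite !lebesgue_measure_itv/= !lte_fin ltr_nM2r ?invr_lt0//.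
  rewrite ltrD2r; case: ifPn => ab; last by rewrite mule0.
  rewrite -!EFinB -EFinM; congr EFin; rewrite ltr0_norm//; field.
  by rewrite lt_eqF.
Qed.

Lemma ge0_integral_affine (c e : R) (A : set R) (f : R -> \bar R) :
  c != 0 -> measurable A -> measurable_fun A f -> (forall x, (0 <= f x)%E) ->
  (\int[mu]_(x in A) f x =
   `|c|%:E * \int[mu]_(x in (fun x => (c * x + e)%R) @^-1` A) f (c * x + e)%R)%E.
Proof.
move=> c0 mA mf f0.
have maff : measurable_fun [set: R] (fun x : R => c * x + e).
  by apply: measurable_funD => //; exact: measurable_funM.
pose m1 : {measure set (measurableTypeR R) -> \bar R} :=
  mscale (NngNum (normr_ge0 c))
    (@image_measure _ _ _ _ (measurableTypeR R) mu _ _ measurableT maff).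
rewrite (@eq_measure_integral _ _ _ _ m1); last first.
  move=> B mB _; have := lebesgue_measure_affine e c0 mB.
  rewrite /m1 /= /mscale/= /image_measure setIT. exact.
rewrite /m1 ge0_integral_mscale//; congr (_ * _)%E.
exact: (@ge0_integral_image_measure _ _ _ (measurableTypeR R) (measurableTypeR R)
  mu (fun x : R => c * x + e) maff A f mA mf f0).
Qed.

End affine.

(** * Centred normal laws *)

Section gauss.
Context {R : realType}.
Local Notation mu := (@lebesgue_measure R).

Lemma normal_pdf0E (s x : R) : 0 < s ->
  normal_pdf 0 s x = normal_peak 1 / s * expR (- (x / s) ^+ 2 / 2).
Proof.
move=> s0; rewrite normal_pdfE ?gt_eqF// /normal_peak /normal_fun subr0.
rewrite expr1n mul1r -[s ^+ 2 * pi *+ 2]mulrnAr sqrtrM ?sqr_ge0// sqrtr_sqr.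
rewrite gtr0_norm// invfM mulrC [_^-1 * _^-1]mulrC mulrC; congr (_ * expR _).
rewrite exprMn exprVn -mulr_natr; field.
by rewrite gt_eqF.
Qed.

Lemma normal_prob_scale (s : R) (A : set R) : 0 < s -> measurable A ->
  normal_prob 0 s A = normal_prob 0 1 ((fun x => s * x) @^-1` A).
Proof.
move=> s0 mA; rewrite /normal_prob.
rewrite (@ge0_integral_affine _ s 0)//=.
- rewrite -ge0_integralZl//=.
  + rewrite (_ : (fun x => s * x + 0) = (fun x => s * x)); last first.
      by apply/funext => x; rewrite addr0.
    apply: eq_integral => x _; rewrite -EFinM; congr EFin.
    rewrite addr0 !normal_pdf0E// gtr0_norm// !divr1 [s * x / s]mulrAC divff ?gt_eqF//.
    by rewrite mul1r; field; rewrite gt_eqF.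
  + rewrite -[X in measurable X]setTI.
    by apply: (measurable_funD (measurable_funM _ _)).
  + apply/measurable_EFinP; apply: measurable_funTS.
    apply: (measurableT_comp (measurable_normal_pdf 0 s)).
    by apply: (measurable_funD (measurable_funM _ _)).
  + by move=> x _; rewrite lee_fin normal_pdf_ge0.
- by rewrite gt_eqF.
- by apply/measurable_EFinP; apply: measurable_funTS; exact: measurable_normal_pdf.
- by move=> x; rewrite lee_fin normal_pdf_ge0.
Qed.

Lemma normal_prob_opp (A : set R) : measurable A ->
  normal_prob 0 1 ((fun x : R => - x) @^-1` A) = normal_prob 0 1 A.
Proof.
move=> mA; rewrite /normal_prob [RHS](@ge0_integral_affine _ (-1) 0)//=.
- rewrite normrN1 mul1e (_ : (fun x => -1 * x + 0) = (fun x : R => - x)); last first.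
    by apply/funext => x; rewrite addr0 mulN1r.
  apply: eq_integral => x _; congr EFin.
  by rewrite addr0 mulN1r !normal_pdf0E// !divr1 sqrrN.
- by apply/measurable_EFinP; apply: measurable_funTS; exact: measurable_normal_pdf.
- by move=> x; rewrite lee_fin normal_pdf_ge0.
Qed.

Lemma measurable_scale (c : R) : measurable_fun [set: R] (fun x : R => c * x).
Proof. exact: measurable_funM. Qed.

(* The centred normal law of variance v: unlike normal_prob 0 (sqrt v), it is the
   Dirac mass at 0 when v = 0. *)
Definition gauss (v : R) : set R -> \bar R :=
  @image_measure R _ _ (measurableTypeR R) R (normal_prob 0 1) setT _ measurableT
    (measurable_scale (Num.sqrt v)).

HB.instance Definition _ (v : R) := Measure.on (gauss v).
HB.instance Definition _ (v : R) := FiniteMeasure.on (gauss v).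

Lemma gaussE (v : R) (A : set R) :
  gauss v A = normal_prob 0 1 ((fun x => Num.sqrt v * x) @^-1` A).
Proof. by rewrite /gauss /image_measure setIT. Qed.

Lemma gauss_normal (v : R) (A : set R) : 0 < v -> measurable A ->
  gauss v A = normal_prob 0 (Num.sqrt v) A.
Proof. by move=> v0 mA; rewrite gaussE [RHS]normal_prob_scale ?sqrtr_gt0. Qed.

Lemma gauss0 (A : set R) : gauss 0 A = (\1_A (0 : R))%:E.
Proof.
rewrite gaussE sqrtr0 indicE; have [A0|A0] := boolP (0 \in A).
  rewrite (_ : _ @^-1` _ = setT) ?probability_setT//.
  by apply/seteqP; split => // x _ /=; rewrite mul0r; exact/set_mem.
rewrite (_ : _ @^-1` _ = set0) ?measure0//.
apply/seteqP; split => // x /=; rewrite mul0r => /mem_set.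
by rewrite (negbTE A0).
Qed.

(** Here c is a coefficient of a step function, so it may have any sign or vanish: the symmetry of
    the standard normal law absorbs a negative sign, and c = 0 gives the Dirac mass at 0. *)
Lemma gauss_scale (c v : R) (A : set R) : measurable A ->
  gauss v ((fun x => c * x) @^-1` A) = gauss (c ^+ 2 * v) A.
Proof.
move=> mA; rewrite !gaussE sqrtrM ?sqr_ge0// sqrtr_sqr -comp_preimage.
have [c0|c0] := leP 0 c.
  rewrite ger0_norm//; congr (normal_prob 0 1 _).
  by apply/seteqP; split => x /=; rewrite mulrA.
rewrite ltr0_norm// -[RHS]normal_prob_opp; last first.
  rewrite -[X in measurable X]setTI.
  exact: (measurable_scale (- c * Num.sqrt v) measurableT mA).
congr (normal_prob 0 1 _).
by apply/seteqP; split => x /=; rewrite mulrN !mulNr opprK mulrA.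
Qed.

End gauss.

(** * Sums of increments of the Wiener process *)

Section independence.
Context {d : measure_display} {Omega : measurableType d} {R : realType}.
Variable P : probability Omega R.

Lemma mutually_independent2 (I : eqType) (F : I -> set (set Omega)) (i j : I)
    (A B : set Omega) :
  mutually_independent P F -> i != j -> F i A -> F j B ->
  P (A `&` B) = (P A * P B)%E.
Proof.
move=> H ij FA FB.
have ji : (j == i) = false by rewrite eq_sym; apply/negbTE.
have := H [:: i; j] (fun k => if k == i then A else B).
rewrite /= inE ij => /(_ isT); rewrite !big_cons big_nil mule1 eqxx ji => <-.
  congr (P _); apply/seteqP; split => [om [Ao Bo] k|om /= h].
    by rewrite /= !inE => /orP[]/eqP->; rewrite ?eqxx ?ji.
  split; first by have := h i; rewrite /= !inE eqxx => /(_ isT).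
  by have := h j; rewrite /= !inE eqxx ji orbT => /(_ isT).
by move=> k; rewrite !inE => /orP[]/eqP->; rewrite ?eqxx ?ji.
Qed.

Lemma mutually_independent3 (I : eqType) (F : I -> set (set Omega)) (i j k : I)
    (A B C : set Omega) :
  mutually_independent P F -> uniq [:: i; j; k] -> F i A -> F j B -> F k C ->
  P (A `&` (B `&` C)) = (P A * (P B * P C))%E.
Proof.
move=> H u FA FB FC; move: (u); rewrite /= !inE !negb_or andbT.
move=> /andP[/andP[ij ik] jk].
have ji : (j == i) = false by rewrite eq_sym; apply/negbTE.
have ki : (k == i) = false by rewrite eq_sym; apply/negbTE.
have kj : (k == j) = false by rewrite eq_sym; apply/negbTE.
have := H [:: i; j; k] (fun l => if l == i then A else if l == j then B else C).
move=> /(_ u); rewrite !big_cons big_nil mule1 !eqxx ji ki kj => <-.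
  congr (P _); apply/seteqP; split => [om [Ao [Bo Co]] l|om /= h].
    by rewrite /= !inE => /or3P[]/eqP->; rewrite ?eqxx ?ji ?ki ?kj.
  split; first by have := h i; rewrite /= !inE eqxx => /(_ isT).
  split; first by have := h j; rewrite /= !inE eqxx ji orbT => /(_ isT).
  by have := h k; rewrite /= !inE eqxx ki kj !orbT => /(_ isT).
by move=> l; rewrite !inE => /or3P[]/eqP->; rewrite ?eqxx ?ji ?ki ?kj.
Qed.

Lemma sigma_algebra_of_preimage d' (E : measurableType d') (Y : Omega -> E)
    (A : set E) : measurable A -> sigma_algebra_of Y (Y @^-1` A).
Proof. by move=> mA; exists A => //; rewrite setTI. Qed.

End independence.

Section wiener_sums.
Context {d : measure_display} {Omega : measurableType d} {R : realType}.
Variables (P : probability Omega R) (W : R -> {RV P >-> R}).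
Hypothesis HW : wiener_process W.

Let dW (s t : R) (om : Omega) : R := W t om - W s om.

Let mdW s t : measurable_fun [set: Omega] (dW s t).
Proof. exact: measurable_funB. Qed.

(** The case s = t, where both sides are the Dirac mass at 0, is included because partitions are
    only nondecreasing and may repeat points. *)
Lemma wiener_increment_law (s t : R) (A : set R) : 0 <= s -> s <= t ->
  measurable A -> P (dW s t @^-1` A) = gauss (t - s) A.
Proof.
move=> s0; rewrite le_eqVlt => /predU1P[<- mA|st mA].
  rewrite subrr gauss0 indicE; have [A0|A0] := boolP (0 \in A).
    rewrite (_ : _ @^-1` _ = setT) ?probability_setT//.
    by apply/seteqP; split => // x _ /=; rewrite /dW subrr; exact/set_mem.
  rewrite (_ : _ @^-1` _ = set0) ?measure0//.
  apply/seteqP; split => // x /=; rewrite /dW subrr => /mem_set.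
  by rewrite (negbTE A0).
by rewrite gauss_normal ?subr_gt0//; exact: wiener_increments_normal.
Qed.

(* The convolution formula is read off from the independence of W_a - W_0 and
   W_{a+b} - W_a, whose sum is W_{a+b} - W_0. *)
Lemma gauss_convolution (a b : R) (A : set R) : 0 <= a -> 0 <= b ->
  measurable A ->
  (\int[gauss a]_x gauss b ((fun y => (x + y)%R) @^-1` A))%E = gauss (a + b) A.
Proof.
move=> a0 b0 mA.
pose C : set (R * R) := (fun z => z.1 + z.2) @^-1` A.
have mC : measurable C.
  rewrite -[X in measurable X]setTI.
  by apply: (measurable_funD measurable_fst measurable_snd).
have ab : a <= a + b by rewrite lerDl.
have H (A1 A2 : set R) : measurable A1 -> measurable A2 ->
    P ((dW 0 a @^-1` A1 `&` dW a (a + b) @^-1` A2) `&` setT) =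
    (gauss a A1 * gauss b A2)%E.
  move=> mA1 mA2; rewrite setIT.
  have := @wiener_increments_indep _ _ _ _ _ HW 2
    (fun i => if i == 0%N then 0 else if i == 1%N then a else a + b) (lexx _).
  have h : forall i, (i < 2)%N -> (if i == 0%N then 0 else if i == 1%N then a else a + b)
    <= (if i.+1 == 0%N then 0 else if i.+1 == 1%N then a else a + b).
    by case=> [|[|]].
  move=> /(_ h) /(@mutually_independent2 _ _ _ P _ _ ord0 ord_max
     (dW 0 a @^-1` A1) (dW a (a + b) @^-1` A2)) ->//=.
  - rewrite !wiener_increment_law//; first by rewrite subr0 addrAC subrr add0r.
  - exact: sigma_algebra_of_preimage.
  - exact: sigma_algebra_of_preimage.
have := joint_law_of_rectangles measurableT (mdW 0 a) (mdW a (a + b)) H mC.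
rewrite setIT (_ : [set om | _] = dW 0 (a + b) @^-1` A); last first.
  apply/seteqP; split => om; rewrite /C/= /dW.
    by rewrite addrC subrKA.
  by rewrite [X in _ -> A X]addrC subrKA.
move=> E; transitivity (P (dW 0 (a + b) @^-1` A)); last first.
  by rewrite wiener_increment_law ?addr_ge0// subr0.
apply/esym; apply: etrans E _.
apply: eq_integral => x _; congr gauss; apply/seteqP; split => y /=;
  by rewrite /xsection/= inE.
Qed.

End wiener_sums.

Section wiener_steps.
Context {d : measure_display} {Omega : measurableType d} {R : realType}.
Variables (P : probability Omega R) (W : R -> {RV P >-> R}).
Hypothesis HW : wiener_process W.

Let dW (s t : R) (om : Omega) : R := W t om - W s om.

Let mdW s t : measurable_fun [set: Omega] (dW s t).
Proof. exact: measurable_funB. Qed.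

Lemma measurable_step_integral (n : nat) (s c : nat -> R) :
  measurable_fun [set: Omega] (step_integral W n s c).
Proof.
rewrite /step_integral; apply: measurable_sum => i; apply: measurable_funM => //.
exact: mdW.
Qed.

Lemma measurable_sigma_algebra_of d' (E : measurableType d')
    (Y : Omega -> E) (A : set Omega) :
  measurable_fun [set: Omega] Y -> sigma_algebra_of Y A -> measurable A.
Proof. by move=> mY [B mB <-]; exact: mY. Qed.

(* The events on the later increments are carried along so that the induction on
   k needs no independence beyond that of finitely many increments. *)
Lemma wiener_steps_law (n : nat) (s c : nat -> R) : 0 <= s 0%N ->
  (forall i, (i < n)%N -> s i <= s i.+1) ->
  forall k, (k <= n)%N -> forall (E : 'I_n -> set Omega),
  (forall i : 'I_n, sigma_algebra_of (dW (s i) (s i.+1)) (E i)) ->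
  forall A, measurable A ->
  P (step_integral W k s c @^-1` A `&`
     \bigcap_(i in [set i : 'I_n | (k <= i)%N]) E i) =
  (gauss (\sum_(i < k) c i ^+ 2 * (s i.+1 - s i)) A *
   \prod_(i < n | (k <= i)%N) P (E i))%E.
Proof.
move=> s0 sS.
have sge0 i : (i <= n)%N -> 0 <= s i.
  elim: i => // i IH ilen; apply: (le_trans (IH (ltnW ilen))); exact: sS.
have tail k (E : 'I_n -> set Omega) :
    (forall i : 'I_n, sigma_algebra_of (dW (s i) (s i.+1)) (E i)) ->
    P (\bigcap_(i in [set i : 'I_n | (k <= i)%N]) E i) =
    (\prod_(i < n | (k <= i)%N) P (E i))%E.
  move=> HE; have := wiener_increments_indep HW s0 sS.
  move=> /(_ (seq.filter (fun i : 'I_n => (k <= i)%N) (enum 'I_n)) E).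
  rewrite filter_uniq ?enum_uniq// => /(_ isT (fun i _ => HE i)).
  rewrite big_filter big_enum_cond/= => <-; congr (P _).
  by congr bigcap; apply/seteqP; split => i /=; rewrite mem_filter mem_enum andbT.
elim=> [_ E HE A mA|k IH kn E HE A mA].
  rewrite big_ord0 gauss0 indicE -(tail 0%N)//.
  have [A0|A0] := boolP (0 \in A).
    rewrite (_ : _ @^-1` _ = setT) ?setTI ?mul1e//.
    apply/seteqP; split => // x _ /=; rewrite /step_integral big_ord0.
    exact/set_mem.
  rewrite (_ : _ @^-1` _ = set0) ?set0I ?measure0 ?mul0e//.
  apply/seteqP; split => // x /=; rewrite /step_integral big_ord0 => /mem_set.
  by rewrite (negbTE A0).
pose ko := Ordinal kn.
pose T := \bigcap_(i in [set i : 'I_n | (k < i)%N]) E i.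
have mT : measurable T.
  apply: fin_bigcap_measurable => // i _.
  exact: (measurable_sigma_algebra_of (@mdW _ _) (HE i)).
pose p := (\prod_(i < n | (k < i)%N) P (E i))%E.
pose v := \sum_(i < k) c i ^+ 2 * (s i.+1 - s i).
pose Y := step_integral W k s c.
have mY : measurable_fun [set: Omega] Y by exact: measurable_step_integral.
have IHB B A2 : sigma_algebra_of (dW (s k) (s k.+1)) B -> measurable A2 ->
    P (Y @^-1` A2 `&` (B `&` T)) = (gauss v A2 * (P B * p))%E.
  (* The k-th event is replaced by [B] and the later ones are kept, so that the induction hypothesis
     at k makes the partial sum, [B] and [T] independent. *)
  move=> HB mA2; pose E' i := if i == ko then B else E i.
  have E'ko : E' ko = B by rewrite /E' eqxx.
  have := IH (ltnW kn) E' _ A2 mA2.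
  rewrite (bigD1 ko)//= E'ko => IH'.
  have -> : p = (\prod_(i < n | (k <= i)%N && (i != ko)) P (E' i))%E.
    apply: eq_big => [i|i ki]; last first.
      by rewrite /E'; case: eqP ki => // ->; rewrite ltnn.
    by rewrite ltn_neqAle andbC -val_eqE/= eq_sym.
  rewrite -IH'; last first.
    by move=> i; rewrite /E'; case: eqP => [->|].
  congr (P (_ `&` _)); apply/seteqP; split => [om [Bo To] i /= ki|om h].
    rewrite /E'; case: eqP => // /eqP iko; apply: To => /=.
    by rewrite ltn_neqAle ki andbT eq_sym -(inj_eq val_inj)/= in iko *.
  split; first by have := h ko (leqnn k); rewrite /E' eqxx.
  move=> i /= ki; have := h i (ltnW ki); rewrite /E'; case: eqP => // iko.
  by rewrite iko ltnn in ki.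
pose X om := c k * dW (s k) (s k.+1) om.
have mX : measurable_fun [set: Omega] X by apply: measurable_funM => //; exact: mdW.
pose w := c k ^+ 2 * (s k.+1 - s k).
have sk : s k <= s k.+1 by exact: sS.
have XE A1 : X @^-1` A1 = dW (s k) (s k.+1) @^-1` ((fun x => c k * x) @^-1` A1) by [].
have mcA (A1 : set R) : measurable A1 -> measurable ((fun x => c k * x) @^-1` A1).
  by move=> mA1; rewrite -[X in measurable X]setTI; exact: measurable_scale.
have PT A2 : measurable A2 -> P (Y @^-1` A2 `&` T) = (gauss v A2 * p)%E.
  move=> mA2; have := IHB setT A2; rewrite setTI probability_setT mul1e; apply => //.
  by exists setT => //; rewrite setTI preimage_setT.
(* The probability of the later events is absorbed into the second factor, the law of the partial
   sum on [T]. *)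
have H (A1 A2 : set R) : measurable A1 -> measurable A2 ->
    P ((X @^-1` A1 `&` Y @^-1` A2) `&` T) =
    (gauss w A1 * image_measure P mT mY A2)%E.
  move=> mA1 mA2; rewrite /image_measure PT// (setIC (X @^-1` A1)) -setIA.
  rewrite IHB//; last by rewrite XE; apply: sigma_algebra_of_preimage; exact: mcA.
  rewrite XE (wiener_increment_law HW)//; [|exact: sge0 (ltnW kn)|exact: mcA].
  by rewrite gauss_scale// muleCA.
pose C : set (R * R) := (fun z => z.1 + z.2) @^-1` A.
have mC : measurable C.
  rewrite -[X in measurable X]setTI.
  by apply: (measurable_funD measurable_fst measurable_snd).
have := joint_law_of_rectangles mT mX mY H mC.
rewrite (_ : [set om | _] = step_integral W k.+1 s c @^-1` A); last first.
  apply/seteqP; split => om; rewrite /C/= /X /Y /step_integral big_ord_recr/=.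
    by rewrite addrC.
  by rewrite addrC.
move=> E1; apply: etrans E1 _.
have secE x : xsection C x = (fun y => x + y) @^-1` A.
  by apply/seteqP; split => y /=; rewrite /xsection/= inE.
have msec x : measurable ((fun y => x + y) @^-1` A).
  by rewrite -secE; exact: measurable_xsection.
rewrite big_ord_recr/= -/v -/w addrC -(gauss_convolution HW)//; last 2 first.
- by rewrite mulr_ge0 ?sqr_ge0// subr_ge0.
- apply: sumr_ge0 => i _; rewrite mulr_ge0 ?sqr_ge0// subr_ge0; apply: sS.
  exact: (ltn_trans (ltn_ord i) kn).
rewrite -ge0_integralZr//=.
- apply: eq_integral => x _; rewrite secE -PT//.
- have := @measurable_fun_xsection _ _ R R R (gauss v) C mC.
  by apply: eq_measurable_fun => x _ /=; rewrite secE.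
- by apply: prode_ge0.
Qed.

End wiener_steps.

Section step_functions.
Context {R : realType}.
Local Notation mu := (@lebesgue_measure R).

(** Summation by parts. A pair in [l] is a weight and a point, and stands for the weight times the
    indicator of ]x0, point]. Once the points are sorted, the coefficient of an increment of F is
    the total weight of the points to its right; on the first interval this is the weight of the
    whole list. *)
Lemma abel_summation (l : seq (R * R)) (x0 : R) :
  path <=%R x0 [seq p.2 | p <- l] ->
  exists n (s c : nat -> R), [/\ s 0%N = x0,
    forall i, (i < n)%N -> s i <= s i.+1 &
    forall F : R -> R, \sum_(p <- l) p.1 * (F p.2 - F x0) =
      \sum_(i < n) c i * (F (s i.+1) - F (s i))].
Proof.
elim: l x0 => [|p l IH] x0 /=.
  by move=> _; exists 0%N, (fun=> x0), (fun=> 0); split => // F; rewrite big_nil big_ord0.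
move=> /andP[x0p /IH[n [s [c [s0 sS HF]]]]].
exists n.+1, (fun i => if i is j.+1 then s j else x0),
  (fun i => if i is j.+1 then c j else \sum_(q <- p :: l) q.1).
split => // [[|i]|F]; [by rewrite s0|exact: sS|].
rewrite big_ord_recl/= -HF s0 !big_cons mulrDl mulr_suml -addrA -big_split/=.
by congr (_ + _); apply: eq_bigr => q _; rewrite -mulrDr; congr (_ * _); ring.
Qed.

(** A common refinement is obtained by sorting rather than merging: each increment c (F(s') - F(s))
    is split into c (F(s') - F(0)) - c (F(s) - F(0)), all weighted points are sorted, and Abel
    summation from 0 restores increments. The partition and the coefficients do not depend on F,
    which is essential for the variance computation. *)
Lemma step_difference_refinement (n n' : nat) (s c s' c' : nat -> R) :
  (forall i, (i <= n)%N -> 0 <= s i) -> (forall i, (i <= n')%N -> 0 <= s' i) ->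
  exists m (x a : nat -> R), [/\ x 0%N = 0,
    forall i, (i < m)%N -> x i <= x i.+1 &
    forall F : R -> R, \sum_(i < n) c i * (F (s i.+1) - F (s i)) -
      \sum_(i < n') c' i * (F (s' i.+1) - F (s' i)) =
      \sum_(i < m) a i * (F (x i.+1) - F (x i))].
Proof.
move=> s0 s'0.
pose l := [seq (c i, s i.+1) | i <- iota 0 n] ++ [seq (- c i, s i) | i <- iota 0 n] ++
  [seq (- c' i, s' i.+1) | i <- iota 0 n'] ++ [seq (c' i, s' i) | i <- iota 0 n'].
pose le2 (p q : R * R) := p.2 <= q.2.
have le2_total : total le2 by move=> p q; exact: le_total.
have lge0 : all (fun p : R * R => 0 <= p.2) l.
  rewrite !all_cat !all_map; apply/and4P; split; apply/allP => i;
    rewrite mem_iota add0n /= => ilt; [exact: s0|exact/s0/ltnW|exact: s'0|exact/s'0/ltnW].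
have pathl : path <=%R 0 [seq p.2 | p <- sort le2 l].
  rewrite path_sortedE; last by move=> ? ? ?; exact: le_trans.
  by rewrite all_map sorted_map sort_sorted// andbT all_sort.
have [m [x [a [x0 xS HF]]]] := abel_summation pathl.
exists m, x, a; split => // F; rewrite -HF.
rewrite (perm_big l)/=; last by rewrite perm_sort.
have ioE k (G : nat -> R) : \sum_(i <- iota 0 k) G i = \sum_(i < k) G i.
  by rewrite -[k in iota 0 k]subn0 -/(index_iota 0 k) big_mkord.
rewrite !big_cat !big_map/= !ioE !addrA -big_split/= -addrA -big_split/=.
rewrite -sumrN; congr (_ + _); apply: eq_bigr => i _; ring.
Qed.

Lemma le_steps (n : nat) (s : nat -> R) :
  (forall i, (i < n)%N -> s i <= s i.+1) ->
  forall i j, (i <= j)%N -> (j <= n)%N -> s i <= s j.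
Proof.
move=> sS i; elim=> [|j IH]; first by rewrite leqn0 => /eqP->.
rewrite leq_eqVlt => /predU1P[->//|ij] jn.
by apply: (le_trans (IH ij (ltnW jn))); exact: sS.
Qed.

(** The intervals ]s_i, s_{i+1}] are disjoint, so the cross terms vanish. *)
Lemma step_function_sqr (n : nat) (s c : nat -> R) (u : R) :
  (forall i, (i < n)%N -> s i <= s i.+1) ->
  step_function n s c u ^+ 2 = \sum_(i < n) c i ^+ 2 * \1_`]s i, s i.+1] u.
Proof.
elim: n => [_|n IH sS]; first by rewrite /step_function !big_ord0 expr0n.
have smono i : (i <= n)%N -> s i <= s n.
  by move=> ilen; apply: (le_steps sS) => //; exact: leqnSn.
rewrite /step_function !big_ord_recr/= -/(step_function n s c u).
rewrite -IH; last by move=> i ilt; apply: sS; exact: ltnW.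
rewrite sqrrD exprMn.
have -> : step_function n s c u * (c n * \1_`]s n, s n.+1] u) = 0.
  rewrite indicE; have [|] := boolP (u \in _); last by rewrite !mulr0.
  rewrite inE/= in_itv/= => /andP[snu _]; rewrite [step_function _ _ _ _]big1 ?mul0r// => i _.
  rewrite indicE memNset ?mulr0//= in_itv/= => /andP[_ usi].
  by have := lt_le_trans snu usi; rewrite ltNge smono.
rewrite mul0rn addr0; congr (_ + _ * _).
by rewrite indicE; case: (_ \in _); rewrite ?expr1n ?expr0n.
Qed.

Lemma integral_step_function_sqr (n : nat) (s c : nat -> R) :
  (forall i, (i < n)%N -> s i <= s i.+1) ->
  (\int[mu]_u (step_function n s c u ^+ 2)%:E =
   (\sum_(i < n) c i ^+ 2 * (s i.+1 - s i))%:E)%E.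
Proof.
move=> sS; under eq_integral do rewrite step_function_sqr//.
under eq_integral do rewrite -sumEFin.
rewrite ge0_integral_sum//=; last 2 first.
- move=> i; apply/measurable_EFinP; apply: measurable_funM => //.
- by move=> i x _; rewrite lee_fin mulr_ge0 ?sqr_ge0.
rewrite -sumEFin; apply: eq_bigr => i _.
under eq_integral do rewrite EFinM.
rewrite ge0_integralZl//=; last 2 first.
- by apply/measurable_EFinP.
- by rewrite lee_fin sqr_ge0.
rewrite integral_indic//= setIT lebesgue_measure_itv/= lte_fin.
case: ifPn => [_|]; first by rewrite -EFinB -EFinM.
rewrite -leNgt => si.
have /eqP -> : s i.+1 == s i by rewrite eq_le si sS.
by rewrite subrr mulr0 mule0.
Qed.

End step_functions.

Section step_difference_law.
Context {d : measure_display} {Omega : measurableType d} {R : realType}.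
Variables (P : probability Omega R) (W : R -> {RV P >-> R}).
Hypothesis HW : wiener_process W.
Local Notation mu := (@lebesgue_measure R).

(** This is the Ito isometry, with the normal law, for the difference of two step integrands. The
    same refinement is used with two functions: F(y) = W_y rewrites the integrals as a sum of
    independent normal terms, and F(y) = 1_{]0, y]}(u) rewrites the integrands. Hence the variance
    of that sum is the squared L^2 distance of the integrands. *)
Lemma step_difference_law (n n' : nat) (s c s' c' : nat -> R) :
  0 <= s 0%N -> (forall i, (i < n)%N -> s i <= s i.+1) ->
  0 <= s' 0%N -> (forall i, (i < n')%N -> s' i <= s' i.+1) ->
  exists v : R, [/\ 0 <= v,
    v%:E = (\int[mu]_u
      ((step_function n s c u - step_function n' s' c' u) ^+ 2)%:E)%E &
    forall A, measurable A ->
      P ((fun om => step_integral W n s c om - step_integral W n' s' c' om)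
           @^-1` A) = gauss v A].
Proof.
move=> s0 sS s'0 s'S.
have sge0 i : (i <= n)%N -> 0 <= s i.
  by move=> ilen; apply: (le_trans s0); apply: (le_steps sS).
have s'ge0 i : (i <= n')%N -> 0 <= s' i.
  by move=> ilen; apply: (le_trans s'0); apply: (le_steps s'S).
have [m [x [a [x0 xS H]]]] := step_difference_refinement c c' sge0 s'ge0.
have xge0 i : (i <= m)%N -> 0 <= x i.
  by move=> ilen; rewrite -x0; apply: (le_steps xS).
have ind (p q u : R) : 0 <= p -> p <= q ->
    \1_`]p, q] u = \1_`]0, q] u - \1_`]0, p] u :> R.
  move=> p0 pq; rewrite !indicE !mem_setE !in_itv/=.
  by case: (ltP 0 u); case: (ltP p u); case: (leP u q); case: (leP u p) => /=; lra.
have stepE u : step_function n s c u - step_function n' s' c' u =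
    step_function m x a u.
  have := H (fun y => \1_`]0, y] u); rewrite /step_function => E.
  transitivity (\sum_(i < n) c i * (\1_`]0, s i.+1] u - \1_`]0, s i] u) -
    \sum_(i < n') c' i * (\1_`]0, s' i.+1] u - \1_`]0, s' i] u)); last first.
    by rewrite E; apply: eq_bigr => i _; rewrite -ind ?xS ?xge0// ltnW.
  by congr (_ - _); apply: eq_bigr => i _; rewrite -ind ?sS ?s'S ?sge0 ?s'ge0// ltnW.
exists (\sum_(i < m) a i ^+ 2 * (x i.+1 - x i)); split.
- by apply: sumr_ge0 => i _; rewrite mulr_ge0 ?sqr_ge0// subr_ge0 xS.
- under eq_integral do rewrite stepE.
  by rewrite integral_step_function_sqr.
- move=> A mA.
  have x00 : 0 <= x 0%N by rewrite x0.
  have := @wiener_steps_law _ _ _ P W HW m x a x00 xS m (leqnn m) (fun=> setT) _ A mA.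
  rewrite (_ : [set i : 'I_m | (m <= i)%N] = set0) ?bigcap_set0 ?setIT; last first.
    by apply/seteqP; split => // i /=; rewrite leqNgt ltn_ord.
  rewrite [X in (_ * X)%E]big_pred0 ?mule1; last by move=> i /=; rewrite leqNgt ltn_ord.
  move=> <-; last by move=> i; exists setT => //; rewrite setTI preimage_setT.
  congr (P _); apply/seteqP; split => om /=; by rewrite /step_integral (H (fun y => W y om)).
Qed.

End step_difference_law.

(** * Limits in probability of normal variables *)

Section cdf_uniqueness.
Context {R : realType}.

Lemma finite_measure_unique_cdf
    (m1 m2 : {finite_measure set R -> \bar R}) :
  (forall x : R, m1 `]-oo, x]%classic = m2 `]-oo, x]%classic) ->
  forall A : set R, measurable A -> m1 A = m2 A.
Proof.
move=> H A mA.
have mE : @measurable _ (R : measurableType _) = <<s @ocitv R >> by [].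
apply: (@measure_unique _ R R (@ocitv R)
  (fun k : nat => `](- k%:R), k%:R]%classic) mE _ _ _ m1 m2) => //.
- by move=> B C; exact: ocitvI.
- by move=> k; exact: is_ocitv.
- exact: bigcup_itvT.
- move=> _ [[a b]] _ <- /=.
  have [ab|ba] := leP a b; last by rewrite set_itv_ge ?measure0// bnd_simp -leNgt ltW.
  have mm (m : {finite_measure set R -> \bar R}) :
      m `]-oo, b]%classic = (m `]-oo, a]%classic + m `]a, b]%classic)%E.
    rewrite -measureU//=; first by rewrite -itv_bndbnd_setU ?bnd_simp.
    apply/seteqP; split => // x [] /=; rewrite !in_itv/= => xa /andP[ax _].
    by rewrite ltNge xa in ax.
  have fa : m2 `]-oo, a]%classic \is a fin_num by exact: fin_num_measure.
  by rewrite -(addeK (m1 _) fa) [X in (X - _)%E]addeC -{1}H -mm H mm [X in (X - _)%E]addeC addeK.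
- move=> k; rewrite ltey_eq; apply/orP; left; apply: fin_num_measure.
  exact: measurable_itv.
Qed.

End cdf_uniqueness.

Section gauss_limit.
Context {R : realType}.
Local Notation mu := (@lebesgue_measure R).

Definition normal_cdf (x : R) : R := fine (normal_prob 0 1 (`]-oo, x]%classic : set R)).

Lemma normal_cdfE (x : R) : (normal_cdf x)%:E = normal_prob 0 1 `]-oo, x]%classic.
Proof. by rewrite /normal_cdf fineK// fin_num_measure. Qed.

Lemma gauss_cdf (v x : R) : 0 < v ->
  gauss v `]-oo, x]%classic = (normal_cdf (x / Num.sqrt v))%:E.
Proof.
move=> v0; rewrite gaussE normal_cdfE; congr (normal_prob 0 1 _).
by apply/seteqP; split => y /=; rewrite !in_itv/= ler_pdivlMr ?sqrtr_gt0// mulrC.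
Qed.

(** The Lipschitz constant is the maximum of the standard normal density. It makes the passage to
    the limit below quantitative. *)
Lemma normal_cdf_lipschitz (x y : R) : x <= y ->
  normal_cdf x <= normal_cdf y <= normal_cdf x + normal_peak 1 * (y - x).
Proof.
move=> xy.
have E : normal_prob 0 1 `]-oo, y]%classic =
    (normal_prob 0 1 `]-oo, x]%classic + normal_prob 0 1 `]x, y]%classic)%E.
  rewrite -measureU//=; first by rewrite -itv_bndbnd_setU ?bnd_simp.
  apply/seteqP; split => // z [] /=; rewrite !in_itv/= => xa /andP[ax _].
  by rewrite ltNge xa in ax.
have le : (normal_prob 0 1 `]x, y]%classic <= (normal_peak 1 * (y - x))%:E)%E.
  rewrite /normal_prob.
  apply: (@le_trans _ _ (\int[mu]_(z in `]x, y]) (normal_peak 1)%:E))%E.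
    apply: ge0_le_integral => //=.
    - by move=> z _; rewrite lee_fin normal_pdf_ge0.
    - by apply/measurable_EFinP; apply: measurable_funTS; exact: measurable_normal_pdf.
    - by move=> z _; rewrite lee_fin normal_pdf_ub ?oner_eq0.
  rewrite integral_cst//= lebesgue_measure_itv/= lte_fin.
  case: ifPn => [_|]; first by rewrite -EFinB -EFinM.
  by rewrite mule0 lee_fin mulr_ge0 ?normal_peak_ge0// subr_ge0.
by rewrite -!lee_fin EFinD !normal_cdfE E leeDl//= leeD2l.
Qed.

(** On E, the event D <= x is squeezed between Z_n <= x - ep and Z_n <= x + ep, up to the event |Z_n
    - D| >= ep, and the normal distribution function is continuous in x and in the variance v > 0.
    Intersecting with E throughout is what lets independence survive the limit, where D need not be
    measurable for the sigma-algebra that makes the Z_n independent of E. *)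
Lemma gauss_limit_law {d : measure_display} {Omega : measurableType d}
    (P : probability Omega R) (Z : nat -> Omega -> R) (D : Omega -> R)
    (v_ : nat -> R) (v : R) (E : set Omega) :
  (forall n, measurable_fun [set: Omega] (Z n)) ->
  measurable_fun [set: Omega] D -> measurable E -> 0 < v ->
  v_ n @[n --> \oo] --> v ->
  (forall n A, measurable A -> P (Z n @^-1` A `&` E) = (gauss (v_ n) A * P E)%E) ->
  (forall e, 0 < e ->
     fine (P [set om | e <= `|Z n om - D om|]) @[n --> \oo] --> (0 : R)) ->
  forall A, measurable A -> P (D @^-1` A `&` E) = (gauss v A * P E)%E.
Proof.
move=> mZ mD mE v0 vcv HZ Hcv.
have mpre (F : Omega -> R) A : measurable_fun setT F -> measurable A ->
    measurable (F @^-1` A).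
  by move=> mF mA; rewrite -[X in measurable X]setTI; exact: mF.
pose p := fine (P E).
have pE : P E = p%:E by rewrite /p fineK// fin_num_measure.
have p0 : 0 <= p by rewrite fine_ge0.
have p1 : p <= 1 by rewrite -lee_fin -pE probability_le1.
suff H (x : R) : P (D @^-1` `]-oo, x]%classic `&` E) = (normal_cdf (x / Num.sqrt v) * p)%:E.
  move=> A mA.
  pose m1 : {finite_measure set R -> \bar R} :=
    image_measure P mE mD.
  pose m2 : {finite_measure set R -> \bar R} :=
    mscale (NngNum p0) (gauss v).
  have := @finite_measure_unique_cdf _ m1 m2 _ A mA.
  rewrite /m1 /m2 /= /mscale /image_measure/= pE muleC; apply => x.
  by rewrite H gauss_cdf// -EFinM mulrC.
pose F := fine (P (D @^-1` `]-oo, x]%classic `&` E)).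
have mDx : measurable (D @^-1` `]-oo, x]%classic `&` E).
  by apply: measurableI => //; exact: mpre.
have FE : P (D @^-1` `]-oo, x]%classic `&` E) = F%:E by rewrite /F fineK// fin_num_measure.
rewrite FE; congr EFin.
(* [normal_peak 1] accounts for a shift by [eta] in the argument of the distribution function, and 1
   for the probability of |Z_n - D| >= ep, made smaller than [eta]. *)
pose K : R := normal_peak 1 + 1.
have K0 : 0 < K by rewrite /K ltr_wpDl// normal_peak_ge0.
have sv0 : 0 < Num.sqrt v by rewrite sqrtr_gt0.
suff bnd (eta : R) : 0 < eta -> `|F - normal_cdf (x / Num.sqrt v) * p| <= K * eta.
  apply/eqP; rewrite -subr_eq0 -normr_le0; apply/ler_addgt0Pr => e e0.
  rewrite add0r (le_trans (bnd (e / K) _)) ?divr_gt0//.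
  by rewrite mulrC divfK ?gt_eqF.
move=> eta0.
(* Chosen so that ep / sqrt v = eta / 2; the other half of [eta] pays for replacing v by v_n. *)
pose ep := eta * Num.sqrt v / 2.
have ep0 : 0 < ep by rewrite divr_gt0// mulr_gt0.
have cy (s : R) : (x + s) / Num.sqrt (v_ n) @[n --> \oo] --> (x + s) / Num.sqrt v.
  apply: cvgM; first exact: cvg_cst.
  apply: cvgV; first by rewrite gt_eqF.
  by apply: cvg_comp vcv _; exact: sqrt_continuous.
have eta2 : 0 < eta / 2 by rewrite divr_gt0.
have /cvgrPdist_lt /(_ _ eta2) c1 := cy ep.
have /cvgrPdist_lt /(_ _ eta2) c2 := cy (- ep).
have /cvgrPdist_lt /(_ _ eta0) c3 := Hcv _ ep0.
have /cvgrPdist_lt /(_ _ v0) c4 := vcv.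
near \oo => n.
have vn0 : 0 < v_ n.
  have : `|v - v_ n| < v by near: n; exact: c4.
  by rewrite ltr_norml => /andP[]; lra.
have d1 : `|(x + ep) / Num.sqrt v - (x + ep) / Num.sqrt (v_ n)| < eta / 2.
  by near: n; exact: c1.
have d2 : `|(x - ep) / Num.sqrt v - (x - ep) / Num.sqrt (v_ n)| < eta / 2.
  by near: n; exact: c2.
have d3 : `|0 - fine (P [set om | ep <= `|Z n om - D om|])| < eta.
  by near: n; exact: c3.
have epv : ep / Num.sqrt v = eta / 2 by rewrite /ep; field; rewrite gt_eqF.
set q := fine (P _) in d3.
pose B := [set om | ep <= `|Z n om - D om|].
have mB : measurable B.
  rewrite -[X in measurable X]setTI.
  have : measurable_fun [set: Omega] (fun om => `|Z n om - D om|).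
    by apply: measurableT_comp => //; exact: measurable_funB.
  move=> /(_ measurableT `[ep, +oo[%classic) /(_ (measurable_itv _)).
  by congr measurable; apply/seteqP; split => om /=; rewrite in_itv/= andbT.
have qE : P B = q%:E by rewrite /q fineK// fin_num_measure.
have qeta : q < eta by move: d3; rewrite sub0r normrN ger0_norm// fine_ge0.
have ZE y : P (Z n @^-1` `]-oo, y]%classic `&` E) =
    (normal_cdf (y / Num.sqrt (v_ n)) * p)%:E.
  by rewrite HZ// gauss_cdf// pE.
have mZx y : measurable (Z n @^-1` `]-oo, y]%classic `&` E).
  by apply: measurableI => //; exact: mpre.
have up : F <= normal_cdf ((x + ep) / Num.sqrt (v_ n)) * p + q.
  rewrite -lee_fin EFinD -FE -ZE -qE.
  apply: le_trans (measureU2 _ _ _) => //.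
  apply: le_measure; rewrite ?inE//; first exact: measurableU.
  move=> om [/= + Eo]; rewrite in_itv/= => Dx.
  have [Bo|Bo] := boolP (ep <= `|Z n om - D om|); first by right.
  left; split => //=; rewrite in_itv/=.
  by move: Bo; rewrite -ltNge ltr_norml => /andP[]; lra.
have dn : normal_cdf ((x - ep) / Num.sqrt (v_ n)) * p <= F + q.
  rewrite -lee_fin EFinD -FE -ZE -qE.
  apply: le_trans (measureU2 _ _ _) => //.
  apply: le_measure; rewrite ?inE//; first exact: measurableU.
  move=> om [/= + Eo]; rewrite in_itv/= => Dx.
  have [Bo|Bo] := boolP (ep <= `|Z n om - D om|); first by right.
  left; split => //=; rewrite in_itv/=.
  by move: Bo; rewrite -ltNge ltr_norml => /andP[]; lra.
have k0 := @normal_peak_ge0 R 1.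
have up' : normal_cdf ((x + ep) / Num.sqrt (v_ n)) <=
    normal_cdf (x / Num.sqrt v) + normal_peak 1 * eta.
  apply: (@le_trans _ _ (normal_cdf (x / Num.sqrt v + eta))).
    have h : (x + ep) / Num.sqrt (v_ n) <= x / Num.sqrt v + eta.
      by move: d1; rewrite [in X in X -> _]mulrDl epv ltr_norml => /andP[]; lra.
    by have /andP[] := normal_cdf_lipschitz h.
  have h : x / Num.sqrt v <= x / Num.sqrt v + eta by rewrite lerDl ltW.
  have /andP[_] := normal_cdf_lipschitz h.
  by rewrite [_ + eta - _]addrAC subrr add0r.
have dn' : normal_cdf (x / Num.sqrt v) - normal_peak 1 * eta <=
    normal_cdf ((x - ep) / Num.sqrt (v_ n)).
  apply: (@le_trans _ _ (normal_cdf (x / Num.sqrt v - eta))).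
    have h : x / Num.sqrt v - eta <= x / Num.sqrt v by rewrite gerBl ltW.
    have /andP[_] := normal_cdf_lipschitz h.
    by rewrite opprB addrCA subrr addr0; lra.
  have h : x / Num.sqrt v - eta <= (x - ep) / Num.sqrt (v_ n).
    by move: d2; rewrite [in X in X -> _]mulrBl epv ltr_norml => /andP[]; lra.
  by have /andP[] := normal_cdf_lipschitz h.
have kp : normal_peak 1 * eta * p <= normal_peak 1 * eta.
  by rewrite ler_piMr// mulr_ge0// ltW.
have up2 := ler_wpM2r p0 up'; have dn2 := ler_wpM2r p0 dn'.
rewrite [leRHS]mulrDl in up2; rewrite [leLHS]mulrBl in dn2.
rewrite /K mulrDl mul1r ler_norml; apply/andP; split; lra.
Unshelve. all: by end_near.
Qed.

End gauss_limit.

(** * Increments of the Wiener integral *)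

Section sigma_families.
Context {d : measure_display} {Omega : measurableType d} {R : realType}.

(** Measurability for the sigma-algebra generated by a family is expressed by changing the structure
    on [Omega] to [g_sigma_algebraType], so that the closure properties of measurable functions
    apply to it unchanged. *)
Lemma measurable_fun_sigma_family (I : Type) d' (E : measurableType d')
    (D : set I) (Y : I -> Omega -> E) (i : I) : D i ->
  @measurable_fun _ _
    (g_sigma_algebraType (\bigcup_(i in D) sigma_algebra_of (Y i))) E setT (Y i).
Proof.
move=> Di _ B mB; apply: sub_gen_smallest; exists i => //.
by exists B.
Qed.

Lemma sigma_family_preimage (I : Type) d' (E : measurableType d')
    (D : set I) (Y : I -> Omega -> E) d'' (E' : measurableType d'')
    (f : Omega -> E') (A : set E') :
  @measurable_fun _ _
    (g_sigma_algebraType (\bigcup_(i in D) sigma_algebra_of (Y i))) E' setT f ->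
  measurable A -> sigma_algebra_of_family D Y (f @^-1` A).
Proof. by move=> mf mA; have := mf measurableT A mA; rewrite setTI. Qed.

Lemma measurable_sigma_family_step_integral (W : R -> Omega -> R) (n : nat) (s c : nat -> R) :
  (forall i, (i <= n)%N -> 0 <= s i) ->
  @measurable_fun _ _
    (g_sigma_algebraType (\bigcup_(i in `[0, +oo[) sigma_algebra_of (W i))) R setT
    (step_integral W n s c).
Proof.
move=> s0; rewrite /step_integral.
apply: measurable_sum => i.
have W0 j : (j <= n)%N -> @measurable_fun _ _
    (g_sigma_algebraType (\bigcup_(i in `[0, +oo[) sigma_algebra_of (W i))) R setT
    (W (s j)).
  by move=> jn; apply: measurable_fun_sigma_family; rewrite /= in_itv/= andbT s0.
apply: measurable_funM => //; apply: measurable_funB; apply: W0 => //.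
exact: ltnW.
Qed.

End sigma_families.

Section convergence_in_mean_square.
Context {R : realType}.

Lemma near_lt_of_cvge0 (u : nat -> \bar R) (r : R) :
  u n @[n --> \oo] --> 0%E -> 0 < r -> \forall n \near \oo, (u n < r%:E)%E.
Proof.
move=> /fine_cvgP[ufin /cvgrPdist_lt uc] r0.
near=> n.
have un : u n \is a fin_num by near: n.
have : `|0 - fine (u n)| < r by near: n; exact: uc.
rewrite sub0r normrN -(fineK un) lte_fin; exact/le_lt_trans/ler_norm.
Unshelve. all: by end_near.
Qed.

Lemma chebyshev_sqr {d : measure_display} {Omega : measurableType d}
    (P : probability Omega R) (Y : Omega -> R) (e : R) :
  measurable_fun [set: Omega] Y -> 0 < e ->
  ((e ^+ 2)%:E * P [set om | (e <= `|Y om|)%R] <= 'E_P[fun om => (Y om ^+ 2)%R])%E.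
Proof.
move=> mY e0.
pose B := [set om | e <= `|Y om|].
have mB : measurable B.
  rewrite -[X in measurable X]setTI.
  have : measurable_fun [set: Omega] (fun om => `|Y om|) by exact: measurableT_comp.
  move=> /(_ measurableT `[e, +oo[%classic) /(_ (measurable_itv _)).
  by congr measurable; apply/seteqP; split => om /=; rewrite in_itv/= andbT.
have mY2 : measurable_fun [set: Omega] (fun om => (Y om ^+ 2)%:E).
  by apply/measurable_EFinP; exact: measurable_funX.
rewrite unlock -integral_cst//.
apply: (@le_trans _ _ (\int[P]_(x in B) (Y x ^+ 2)%:E)%E).
  apply: ge0_le_integral => //.
  - by move=> x _; rewrite lee_fin sqr_ge0.
  - exact: measurable_funTS.
  - move=> x /= Bx; rewrite lee_fin -[leRHS]real_normK ?num_real//.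
    by rewrite ler_sqr ?nnegrE// ltW.
by apply: ge0_subset_integral => // x _; rewrite lee_fin sqr_ge0.
Qed.

End convergence_in_mean_square.

Section wiener_integral_increment.
Context {d : measure_display} {Omega : measurableType d} {R : realType}.
Variables (P : probability Omega R) (W : R -> {RV P >-> R}).
Hypothesis HW : wiener_process W.
Local Notation mu := (@lebesgue_measure R).

Lemma step_function_out (n : nat) (s c : nat -> R) (t u : R) :
  s 0%N = 0 -> s n = t -> (forall i, (i < n)%N -> s i <= s i.+1) ->
  ~ (0 <= u <= t) -> step_function n s c u = 0.
Proof.
move=> s0 sn sS ut; rewrite /step_function big1// => i _.
rewrite indicE memNset ?mulr0//= in_itv/= => /andP[siu usi]; apply: ut.
apply/andP; split.
  by apply: (le_trans _ (ltW siu)); rewrite -s0; apply: (le_steps sS) => //; exact: ltnW.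
by rewrite -sn; apply: (le_trans usi); apply: (le_steps sS).
Qed.

Lemma measurable_step_function (n : nat) (s c : nat -> R) :
  measurable_fun [set: R] (step_function n s c).
Proof.
by rewrite /step_function; apply: measurable_sum => i; apply: measurable_funM.
Qed.

(** Integrated form of a^2 <= (1 + eta) b^2 + (1 + 1/eta) (a - b)^2, which amounts to 0 <= (eta b -
    (a - b))^2 / eta. Applied in both directions it turns L^2 convergence into convergence of
    squared norms, and it holds in the extended reals, with no finiteness to check beforehand. *)
Lemma integral_sqr_stable (D : set R) (a b : R -> R) (eta : R) : measurable D ->
  measurable_fun D a -> measurable_fun D b -> 0 < eta ->
  (\int[mu]_(u in D) (a u ^+ 2)%:E <=
   (1 + eta)%:E * \int[mu]_(u in D) (b u ^+ 2)%:E +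
   (1 + eta^-1)%:E * \int[mu]_(u in D) ((a u - b u) ^+ 2)%:E)%E.
Proof.
move=> mD ma mb e0.
have m2 (f : R -> R) : measurable_fun D f -> measurable_fun D (fun u => (f u ^+ 2)%:E).
  by move=> mf; apply/measurable_EFinP; exact: measurable_funX.
have mab : measurable_fun D (fun u => a u - b u) by exact: measurable_funB.
have c1 : 0 <= 1 + eta by rewrite addr_ge0// ltW.
have c2 : 0 <= 1 + eta^-1 by rewrite addr_ge0// invr_ge0 ltW.
rewrite -!ge0_integralZl//; do ?[exact: m2|by move=> u _; rewrite lee_fin sqr_ge0].
rewrite -ge0_integralD//; last 4 first.
- by move=> u _; rewrite -EFinM lee_fin mulr_ge0 ?sqr_ge0.
- by apply: measurable_funeM; exact: m2.
- by move=> u _; rewrite -EFinM lee_fin mulr_ge0 ?sqr_ge0.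
- by apply: measurable_funeM; exact: m2.
apply: ge0_le_integral => //.
- by move=> u _; rewrite lee_fin sqr_ge0.
- exact: m2.
- by apply: emeasurable_funD; apply: measurable_funeM; exact: m2.
move=> u _; rewrite -!EFinM -EFinD lee_fin.
have : 0 <= (eta * b u - (a u - b u)) ^+ 2 / eta by rewrite divr_ge0 ?sqr_ge0 ?ltW.
rewrite (_ : _ / eta = eta * b u ^+ 2 - 2 * b u * (a u - b u) + (a u - b u) ^+ 2 / eta).
  by rewrite !mulrDl !mul1r [_^-1 * _]mulrC; lra.
by field; rewrite gt_eqF.
Qed.

(** The variance v is the integral of sg^2 over ]t, t + h], the limit of the variances of the
    differences of step integrals; the bounds on sg give those on v. It is chosen before E, so the
    same v serves the event of no jump and all events about the jump sum. *)
Lemma wiener_integral_increment_law (sg : R -> R) (t h sl su : R)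
    (S0 S1 : Omega -> R) :
  0 <= t -> 0 < h -> measurable_fun `[0, t + h] sg -> 0 < sl ->
  (forall u, 0 <= u <= t + h -> sl <= sg u <= su) ->
  measurable_fun [set: Omega] S0 -> measurable_fun [set: Omega] S1 ->
  wiener_integral P W sg t S0 -> wiener_integral P W sg (t + h) S1 ->
  exists v : R, [/\ sl ^+ 2 * h <= v, v <= su ^+ 2 * h &
    forall E, measurable E ->
      (forall B, sigma_algebra_of_family `[0, +oo[ W B -> P (B `&` E) = (P B * P E)%E) ->
    forall A, measurable A ->
      P ((fun om => S1 om - S0 om) @^-1` A `&` E) = (gauss v A * P E)%E].
Proof.
move=> t0 h0 msg sl0 sgb mS0 mS1 [m' [s' [c' [Hs' Hc' HE']]]] [m [s [c [Hs Hc HE]]]].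
have th : t <= t + h by rewrite lerDl ltW.
have th0 : 0 <= t + h by rewrite addr_ge0// ltW.
pose a n u := step_function (m n) (s n) (c n) u - step_function (m' n) (s' n) (c' n) u.
pose D1 : set R := `[0, t + h]%classic.
pose D0 : set R := `[0, t]%classic.
(* The limit of the integrands [a n]: sg on [0, t + h] minus sg on [0, t]. *)
pose b : R -> R := sg \_ `]t, t + h].
have ma n : measurable_fun [set: R] (a n).
  by apply: measurable_funB; exact: measurable_step_function.
have mb : measurable_fun [set: R] b.
  apply/(measurable_restrictT _ (measurable_itv _)).
  apply: measurable_funS msg => // u /=; rewrite !in_itv/= => /andP[tu ->].
  by rewrite andbT (le_trans t0)// ltW.
have s0 n : 0 <= s n 0%N by have [->] := Hs n.
have s'0 n : 0 <= s' n 0%N by have [->] := Hs' n.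
have sS n : forall i, (i < m n)%N -> s n i <= s n i.+1 by have [_ _] := Hs n.
have s'S n : forall i, (i < m' n)%N -> s' n i <= s' n i.+1 by have [_ _] := Hs' n.
have /choice[v_ Hv] : forall n, exists v : R, [/\ 0 <= v,
    v%:E = (\int[mu]_u ((a n u) ^+ 2)%:E)%E &
    forall A, measurable A ->
      P ((fun om => step_integral W (m n) (s n) (c n) om -
           step_integral W (m' n) (s' n) (c' n) om) @^-1` A) = gauss v A].
  move=> n; exact: (step_difference_law HW (c n) (c' n) (s0 n) (sS n) (s'0 n) (s'S n)).
pose V := (\int[mu]_u ((b u) ^+ 2)%:E)%E.
have VE : V = (\int[mu]_(u in `]t, (t + h)%R]) ((sg u) ^+ 2)%:E)%E.
  rewrite [RHS]integral_mkcond; apply: eq_integral => u _; rewrite /b !patchE.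
  by case: ifP; rewrite ?expr0n.
have msg2 : measurable_fun `]t, t + h] (fun u => (sg u ^+ 2)%:E).
  apply/measurable_EFinP; apply: measurable_funX.
  apply: measurable_funS msg => // u /=; rewrite !in_itv/= => /andP[tu ->].
  by rewrite andbT (le_trans t0)// ltW.
have sgb' u : u \in `]t, (t + h)%R] -> sl <= sg u <= su.
  rewrite in_itv/= => /andP[tu uth]; apply: sgb.
  by rewrite uth andbT (le_trans t0)// ltW.
have cstE (r : R) : (\int[mu]_(u in `]t, (t + h)%R]) r%:E = (r * h)%:E)%E.
  rewrite integral_cst//= lebesgue_measure_itv/= lte_fin ltrDl h0 -EFinB -EFinM.
  by rewrite addrAC subrr add0r.
have Vge : ((sl ^+ 2 * h)%:E <= V)%E.
  rewrite VE -cstE; apply: ge0_le_integral => //.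
  - by move=> u _; rewrite lee_fin sqr_ge0.
  - move=> u ut; have /andP[slu _] := sgb' u ut.
    by rewrite lee_fin ler_sqr ?nnegrE// ?(ltW sl0)// (le_trans (ltW sl0)).
have Vle : (V <= (su ^+ 2 * h)%:E)%E.
  rewrite VE -cstE; apply: ge0_le_integral => //.
  - by move=> u _; rewrite lee_fin sqr_ge0.
  - move=> u ut; have /andP[slu ulu] := sgb' u ut.
    have u0 := le_trans (ltW sl0) slu.
    by rewrite lee_fin ler_sqr ?nnegrE// (le_trans u0).
have Vfin : V \is a fin_num.
  rewrite fin_numE; apply/andP; split; apply/eqP => VV.
    by rewrite VV in Vge.
  by rewrite VV in Vle.
pose v := fine V.
have vE : V = v%:E by rewrite /v fineK.
have vl : sl ^+ 2 * h <= v by rewrite -lee_fin -vE.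
have vu : v <= su ^+ 2 * h by rewrite -lee_fin -vE.
have v0 : 0 < v by apply: lt_le_trans vl; rewrite mulr_gt0// exprn_gt0.
pose e n := (\int[mu]_u ((a n u - b u) ^+ 2)%:E)%E.
(* On [0, t] the difference [a n - b] is (p - sg) - (q - sg), where p and q are the two step
   functions, and (x - y)^2 <= 2 x^2 + 2 y^2; on ]t, t + h] only p - sg remains, and outside
   [0, t + h] everything vanishes. *)
have ele n : (e n <=
    2%:E * \int[mu]_(u in `[0%R, (t + h)%R]) ((step_function (m n) (s n) (c n) u - sg u) ^+ 2)%:E +
    2%:E * \int[mu]_(u in `[0%R, t]) ((step_function (m' n) (s' n) (c' n) u - sg u) ^+ 2)%:E)%E.
  pose p u := step_function (m n) (s n) (c n) u.
  pose q u := step_function (m' n) (s' n) (c' n) u.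
  have p0 u : ~ (0 <= u <= t + h) -> p u = 0.
    by have [? ? ?] := Hs n; exact: step_function_out.
  have q0 u : ~ (0 <= u <= t) -> q u = 0.
    by have [? ? ?] := Hs' n; exact: step_function_out.
  have mp : measurable_fun [set: R] p by exact: measurable_step_function.
  have mq : measurable_fun [set: R] q by exact: measurable_step_function.
  have m1 : measurable_fun D1 (fun u => ((p u - sg u) ^+ 2)%:E).
    apply/measurable_EFinP; apply: measurable_funX; apply: measurable_funB => //.
    exact: measurable_funTS.
  have m0 : measurable_fun D0 (fun u => ((q u - sg u) ^+ 2)%:E).
    apply/measurable_EFinP; apply: measurable_funX; apply: measurable_funB => //.
      exact: measurable_funTS.
    apply: measurable_funS msg => // u; rewrite /D0 /mkset !in_itv/= => /andP[u0 ut].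
    by rewrite u0/= (le_trans ut th).
  rewrite integral_mkcond [X in (_ + 2%:E * X)%E]integral_mkcond.
  have r1 : measurable_fun [set: R] ((fun u => ((p u - sg u) ^+ 2)%:E) \_ D1).
    exact/(measurable_restrictT _ (measurable_itv _)).
  have r0 : measurable_fun [set: R] ((fun u => ((q u - sg u) ^+ 2)%:E) \_ D0).
    exact/(measurable_restrictT _ (measurable_itv _)).
  have r1_ge0 u : (0 <= ((fun u => ((p u - sg u) ^+ 2)%:E) \_ D1) u)%E.
    by rewrite patchE; case: ifP => // _; rewrite lee_fin sqr_ge0.
  have r0_ge0 u : (0 <= ((fun u => ((q u - sg u) ^+ 2)%:E) \_ D0) u)%E.
    by rewrite patchE; case: ifP => // _; rewrite lee_fin sqr_ge0.
  rewrite -!ge0_integralZl//.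
  rewrite -ge0_integralD//; last 4 first.
  - by move=> u _; rewrite mule_ge0.
  - exact: measurable_funeM.
  - by move=> u _; rewrite mule_ge0.
  - exact: measurable_funeM.
  apply: ge0_le_integral => //.
  - by move=> u _; rewrite lee_fin sqr_ge0.
  - by apply/measurable_EFinP; apply: measurable_funX; exact: (measurable_funB (ma n) mb).
  - by apply: emeasurable_funD; exact: measurable_funeM.
  move=> u _; rewrite /a /b -/(p u) -/(q u) !patchE !mem_setE !in_itv/=.
  have [u0|u0] := leP 0 u; last first.
    rewrite p0 ?q0 /=; last 2 first.
    - by rewrite leNgt u0.
    - by rewrite leNgt u0.
    by rewrite ltNge (le_trans (ltW u0) t0)/= !subr0 expr0n/= !mule0 adde0.
  have [ut|ut] := leP u t.
    rewrite (le_trans ut th)/= subr0 -!EFinM -EFinD lee_fin.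
    rewrite -/(p u) -/(q u).
    by have := sqr_ge0 (p u - sg u + (q u - sg u)); lra.
  rewrite q0 /=; last by rewrite u0/= leNgt ut.
  have [uth|uth] := leP u (t + h).
    rewrite subr0 mule0 adde0 -EFinM lee_fin.
    by rewrite -/(p u); have := sqr_ge0 (p u - sg u); lra.
  rewrite p0; last by rewrite u0/= leNgt uth.
  by rewrite !subr0 expr0n/= !mule0 adde0.
have ecv : e n @[n --> \oo] --> 0%E.
  apply: (@squeeze_cvge _ _ _ _ (fun=> 0%E) _ (fun n =>
    2%:E * \int[mu]_(u in `[0%R, (t + h)%R]) ((step_function (m n) (s n) (c n) u - sg u) ^+ 2)%:E +
    2%:E * \int[mu]_(u in `[0%R, t]) ((step_function (m' n) (s' n) (c' n) u - sg u) ^+ 2)%:E)%E).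
  - near=> n; rewrite ele andbT; apply: integral_ge0 => u _.
    by rewrite lee_fin sqr_ge0.
  - exact: cvg_cst.
  - have f2 : (2 : R)%:E \is a fin_num by [].
    have := cvgeD _ (cvgeZl f2 Hc) (cvgeZl f2 Hc').
    by rewrite !mule0 adde0; apply.
have vn0 n : 0 <= v_ n by have [] := Hv n.
have vcv : v_ n @[n --> \oo] --> v.
  apply/cvgrPdist_lt => ep ep0.
  (* The second bound gives eta v <= ep / 8. The first keeps v_n below 2 v + ep / 8, so that eta v_n
     is small too; the eighths then add up to at most ep / 2. *)
  pose eta := Num.min 1 (ep / (8 * v)).
  have eta0 : 0 < eta by rewrite lt_min ltr01/= divr_gt0// mulr_gt0.
  have eta1 : eta <= 1 by rewrite ge_min lexx.
  have etav : eta * v <= ep / 8.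
    have : eta <= ep / (8 * v) by rewrite ge_min lexx orbT.
    move=> /(ler_wpM2r (ltW v0)) /le_trans; apply.
    by rewrite invfM mulrA divfK ?gt_eqF.
  pose C := 1 + eta^-1.
  have C0 : 0 < C by rewrite addr_gt0// invr_gt0.
  have r0 : 0 < ep / (8 * C) by rewrite divr_gt0// mulr_gt0.
  have en := near_lt_of_cvge0 ecv r0.
  near=> n.
  have enr : (e n < (ep / (8 * C))%:E)%E by near: n; exact: en.
  have Ce : (C%:E * e n <= (ep / 8)%:E)%E.
    rewrite (_ : ep / 8 = C * (ep / (8 * C))).
      by rewrite EFinM lee_wpmul2l ?lee_fin ?ltW.
    by field; rewrite gt_eqF.
  have up : v_ n <= (1 + eta) * v + ep / 8.
    have [_ Ev _] := Hv n.
    rewrite -lee_fin Ev EFinD EFinM -vE.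
    apply: (le_trans (integral_sqr_stable measurableT (ma n) mb eta0)).
    by rewrite leeD2l.
  have dn : v <= (1 + eta) * v_ n + ep / 8.
    have [_ Ev _] := Hv n.
    rewrite -lee_fin -vE EFinD EFinM Ev.
    apply: (le_trans (integral_sqr_stable measurableT mb (ma n) eta0)).
    rewrite leeD2l//; under eq_integral do rewrite -sqrrN opprB.
    exact: Ce.
  have evn : eta * v_ n <= v_ n by rewrite ler_piMl.
  have evn2 : eta * v_ n <= eta * ((1 + eta) * v + ep / 8) by rewrite ler_pM2l.
  have ee : eta * (eta * v) <= eta * v by rewrite ler_piMl// mulr_ge0 ?ltW.
  have ee2 : eta * (ep / 8) <= ep / 8 by rewrite ler_piMl// divr_ge0 ?ltW.
  by rewrite ltr_norml; apply/andP; split; lra.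
exists v; split=> // E mE HE0.
apply: (gauss_limit_law (Z := fun n om => step_integral W (m n) (s n) (c n) om -
           step_integral W (m' n) (s' n) (c' n) om) (v_ := v_)) => //.
- by move=> n; apply: measurable_funB; exact: measurable_step_integral.
- exact: measurable_funB.
- move=> n A mA; have [_ _ <-//] := Hv n; rewrite HE0//.
  apply: sigma_family_preimage => //.
  apply: measurable_funB; apply: measurable_sigma_family_step_integral => i im.
    by apply: (le_trans (s0 n)); apply: (le_steps (sS n)).
  by apply: (le_trans (s'0 n)); apply: (le_steps (s'S n)).
- move=> ep ep0; apply/cvgrPdist_lt => r r0.
  (* An error of at least [ep] on the increment forces an error of at least [g] at t or at t + h;
     mean squares below g^2 r / 2 make each of these events less likely than r / 2. *)
  pose g := ep / 2.
  have g0 : 0 < g by rewrite divr_gt0.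
  have rg0 : 0 < g ^+ 2 * (r / 2) by rewrite mulr_gt0 ?exprn_gt0// divr_gt0.
  have n1 := near_lt_of_cvge0 HE rg0.
  have n2 := near_lt_of_cvge0 HE' rg0.
  near=> n.
  have lt1 : ('E_P[(fun om => (step_integral W (m n) (s n) (c n) om - S1 om) ^+ 2)%R]
     < (g ^+ 2 * (r / 2))%:E)%E by near: n; exact: n1.
  have lt2 : ('E_P[(fun om => (step_integral W (m' n) (s' n) (c' n) om - S0 om) ^+ 2)%R]
     < (g ^+ 2 * (r / 2))%:E)%E by near: n; exact: n2.
  have mY1 : measurable_fun [set: Omega]
      (fun om => step_integral W (m n) (s n) (c n) om - S1 om).
    by apply: measurable_funB => //; exact: measurable_step_integral.
  have mY2 : measurable_fun [set: Omega]
      (fun om => step_integral W (m' n) (s' n) (c' n) om - S0 om).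
    by apply: measurable_funB => //; exact: measurable_step_integral.
  have prob (Y : Omega -> R) : measurable_fun setT Y ->
      ('E_P[(fun om => (Y om) ^+ 2)%R] < (g ^+ 2 * (r / 2))%:E)%E ->
      (P [set om | (g <= `|Y om|)%R] < (r / 2)%:E)%E.
    move=> mY lt; have := le_lt_trans (chebyshev_sqr P mY g0) lt.
    by rewrite [(_ * (r / 2))%:E]EFinM lte_pmul2l// lte_fin exprn_gt0.
  have mnorm (Y : Omega -> R) (z : R) : measurable_fun setT Y ->
      measurable [set om | z <= `|Y om|].
    move=> mY; rewrite -[X in measurable X]setTI.
    have : measurable_fun [set: Omega] (fun om => `|Y om|) by exact: measurableT_comp.
    move=> /(_ measurableT `[z, +oo[%classic) /(_ (measurable_itv _)).
    by congr measurable; apply/seteqP; split => om /=; rewrite in_itv/= andbT.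
  have p1 := prob _ mY1 lt1; have p2 := prob _ mY2 lt2.
  rewrite sub0r normrN ger0_norm ?fine_ge0// -lte_fin fineK; last first.
    apply: fin_num_measure; apply: (mnorm (fun om => _ - _)).
    by apply: measurable_funB; apply: measurable_funB => //; exact: measurable_step_integral.
  apply: (@le_lt_trans _ _ (P ([set om | (g <= `|step_integral W (m n) (s n) (c n) om - S1 om|)%R]
     `|` [set om | (g <= `|step_integral W (m' n) (s' n) (c' n) om - S0 om|)%R]))).
    apply: le_measure; rewrite ?inE//.
    - apply: (mnorm (fun om => _ - _)).
      by apply: measurable_funB; apply: measurable_funB => //; exact: measurable_step_integral.
    - by apply: measurableU; exact: mnorm.
    move=> om /= le.
    have [?|lt1'] := leP g `|step_integral W (m n) (s n) (c n) om - S1 om|; first by left.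
    right; rewrite leNgt; apply/negP => lt2'.
    move: le; rewrite leNgt => /negP; apply.
    rewrite (_ : _ - _ - _ = (step_integral W (m n) (s n) (c n) om - S1 om) -
      (step_integral W (m' n) (s' n) (c' n) om - S0 om)); last by ring.
    apply: (le_lt_trans (ler_normB _ _)); move: lt1' lt2'; rewrite /g; lra.
  apply: (le_lt_trans (measureU2 _ _ _)); [exact: mnorm|exact: mnorm|].
  by rewrite [r]splitr EFinD lteD.
Unshelve. all: by end_near.
Qed.

End wiener_integral_increment.

(** * Jumps *)

Section coefficients.
Context {R : realType}.
Local Notation mu := (@lebesgue_measure R).

Lemma locally_bounded_away_bounds (g : R -> R) (t : R) :
  locally_bounded_away g -> 0 < t ->
  exists l u : R, 0 < l /\ forall x, 0 <= x <= t -> l <= g x <= u.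
Proof.
move=> Hg t0; have [/andP[i0 _] su] := Hg t t0.
set V := [set _ | _ in _] in i0 su.
have V0 x : 0 <= x <= t -> V (g x)%:E by move=> xt; exists x.
have g0 : V (g 0)%:E by apply: V0; rewrite lexx ltW.
have ifin : ereal_inf V \is a fin_num.
  rewrite ge0_fin_numE ?(ltW i0)//; apply: le_lt_trans (ltry (g 0)).
  exact: ereal_inf_lbound.
have sfin : ereal_sup V \is a fin_num.
  rewrite fin_numE; apply/andP; split; apply/eqP => E.
    by have := ereal_sup_ubound g0; rewrite E leeNy_eq.
  by rewrite E in su.
exists (fine (ereal_inf V)), (fine (ereal_sup V)); split.
  by rewrite -lte_fin fineK.
move=> x xt; rewrite -!lee_fin !fineK//.
by rewrite ereal_inf_lbound ?ereal_sup_ubound//; exact: V0.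
Qed.

Lemma Rintegral_itv_bounds (g : R -> R) (a b l u : R) : a <= b ->
  mu.-integrable `[a, b] (EFin \o g) -> (forall x, a <= x <= b -> l <= g x <= u) ->
  l * (b - a) <= \int[mu]_(x in `[a, b]) g x <= u * (b - a).
Proof.
move=> ab ig lu.
have cstE r : \int[mu]_(x in `[a, b]) r = r * (b - a).
  rewrite Rintegral_cst//= lebesgue_measure_itv/= lte_fin.
  case: ifPn => [_|]; first by [].
  rewrite -leNgt => ba; have -> : a = b by apply/eqP; rewrite eq_le ab.
  by rewrite subrr.
have ic r : mu.-integrable `[a, b] (EFin \o cst r).
  have abfin : (mu `[a, b]%classic < +oo)%E.
    rewrite lebesgue_measure_itv/= lte_fin; case: ifP => _; last exact: ltry.
    by rewrite -EFinB ltry.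
  have := @measurable_bounded_integrable _ _ _ mu (cst r) `[a, b]%classic (measurable_itv _) abfin.
  apply; first exact: measurable_cst.
  exists `|r|; split; first exact: num_real.
  by move=> M rM x _; rewrite /= ltW.
rewrite -!cstE; apply/andP; split; apply: le_Rintegral => //=;
  do ?[exact: ic]; by move=> x; rewrite in_itv/= => /lu/andP[].
Qed.

End coefficients.

Section countable_partitions.
Context {d : measure_display} {Omega : measurableType d} {R : realType}.
Variable P : probability Omega R.

(** If G_n has the same conditional probability k on every cell F_n of a partition, the same holds
    on the union. The event may change with the cell, as does the index of the first jump after
    t. *)
Lemma probability_bigcup_proportional (F G : nat -> set Omega) (k : R) :
  (forall n, measurable (F n)) -> (forall n, measurable (G n)) ->
  trivIset setT F ->
  (forall n, P (G n `&` F n) = (k%:E * P (F n))%E) ->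
  P (\bigcup_n (G n `&` F n)) = (k%:E * P (\bigcup_n F n))%E.
Proof.
move=> mF mG tF H.
rewrite measure_bigcup//; last 2 first.
- by move=> n _; exact: measurableI.
- apply/trivIsetP => i j _ _ ij; move/trivIsetP : tF => /(_ i j I I ij) Fij.
  by rewrite setIACA Fij setI0.
rewrite measure_bigcup// -nneseriesZl//.
by apply: eq_eseriesr => n _; exact: H.
Qed.

End countable_partitions.

Section jumps.
Context {d : measure_display} {Omega : measurableType d} {R : realType}.
Variables (P : probability Omega R).
Variables (W : R -> {RV P >-> R}) (N : R -> {RV P >-> nat}) (zeta : nat -> {RV P >-> R}).
Hypothesis Hindep : independent_drivers W N zeta.

Let SW := sigma_algebra_of_family `[0, +oo[ W.
Let SN := sigma_algebra_of_family `[0, +oo[ N.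
Let SZ := sigma_algebra_of_family [set: nat] zeta.

Lemma drivers_indep (A B C : set Omega) : SW A -> SN B -> SZ C ->
  P (A `&` (B `&` C)) = (P A * (P B * P C))%E.
Proof.
move=> HA HB HC.
pose i0 : 'I_3 := @Ordinal 3 0 isT.
pose i1 : 'I_3 := @Ordinal 3 1 isT.
pose i2 : 'I_3 := @Ordinal 3 2 isT.
exact: (mutually_independent3 Hindep (i := i0) (j := i1) (k := i2)).
Qed.

Lemma sigma_familyT (I : Type) d' (E : measurableType d') (D : set I)
    (Y : I -> Omega -> E) : sigma_algebra_of_family D Y setT.
Proof. exact: (@measurableT _ (g_sigma_algebraType _)). Qed.

Lemma counting_event (t : R) (n : nat) : 0 <= t -> SN [set om | N t om = n].
Proof.
move=> t0; apply: (sigma_family_preimage (f := N t) (A := [set n])) => //.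
by apply: measurable_fun_sigma_family; rewrite /= in_itv/= t0.
Qed.

Lemma jump_sum_event (n n' : nat) (C : set R) : measurable C ->
  SZ [set om | C (\sum_(j < n') zeta j om - \sum_(j < n) zeta j om)].
Proof.
move=> mC; apply: (sigma_family_preimage (A := C)
  (f := fun om => \sum_(j < n') zeta j om - \sum_(j < n) zeta j om)) => //.
by apply: measurable_funB; apply: measurable_sum => j;
  exact: measurable_fun_sigma_family.
Qed.

Lemma sigma_algebra_setI (S : set (set Omega)) (G : set (set Omega)) (A B : set Omega) :
  S = <<s G >> -> S A -> S B -> S (A `&` B).
Proof.
move=> -> HA HB; exact: (@measurableI _ (g_sigma_algebraType G)).
Qed.

Lemma sigma_family_measurable (I : Type) d' (E : measurableType d')
    (D : set I) (Y : I -> {RV P >-> E}) (A : set Omega) :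
  sigma_algebra_of_family D Y A -> measurable A.
Proof.
apply: smallest_sub; first exact: sigma_algebra_measurable.
by move=> _ [i Di [B mB <-]]; exact: measurable_funP.
Qed.

Lemma measurable_jump_part (t : R) :
  measurable_fun [set: Omega] (jump_part N zeta t).
Proof.
move=> _ B mB; rewrite setTI.
rewrite (_ : _ @^-1` B = \bigcup_n ([set om | N t om = n] `&`
    [set om | B (\sum_(j < n) zeta j om)])).
  apply: bigcupT_measurable => n; apply: measurableI.
    rewrite -[X in measurable X]setTI.
    exact: (measurable_funP (N t) measurableT [set n]).
  have : measurable_fun [set: Omega] (fun om => \sum_(j < n) zeta j om).
    exact: measurable_sum.
  by move=> /(_ measurableT B mB); rewrite setTI.
apply/seteqP; split => [om Bo|om [n _ [/= <-]]]; last by [].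
by exists (N t om).
Qed.

End jumps.

Section jump_events.
Context {d : measure_display} {Omega : measurableType d} {R : realType}.
Variables (P : probability Omega R).
Variables (W : R -> {RV P >-> R}) (N : R -> {RV P >-> nat}) (zeta : nat -> {RV P >-> R}).
Hypothesis Hindep : independent_drivers W N zeta.
Variables t t' : R.
Hypotheses (t0 : 0 <= t) (t'0 : 0 <= t').

Let inc om : R := (N t' om)%:R - (N t om)%:R.

Let J om := jump_part N zeta t' om - jump_part N zeta t om.

Let mN u n : measurable [set om | N u om = n].
Proof.
rewrite -[X in measurable X]setTI.
exact: (measurable_funP (N u) measurableT [set n]).
Qed.

Let mZ n n' (C : set R) : measurable C ->
  measurable [set om | C (\sum_(j < n') zeta j om - \sum_(j < n) zeta j om)].
Proof.
move=> mC.
have : measurable_fun [set: Omega]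
    (fun om => \sum_(j < n') zeta j om - \sum_(j < n) zeta j om).
  by apply: measurable_funB; exact: measurable_sum.
by move=> /(_ measurableT C mC); rewrite setTI.
Qed.

Lemma measurable_jump_count (r : R) : measurable [set om | inc om = r].
Proof.
have mn u : measurable_fun [set: Omega] (fun om => (N u om)%:R : R).
  by apply: (measurableT_comp (f := fun n : nat => n%:R : R)).
have : measurable_fun [set: Omega] (fun om => (N t' om)%:R - (N t om)%:R : R).
  exact: measurable_funB.
by move=> /(_ measurableT [set r] (measurable_set1 _)); rewrite setTI.
Qed.

Lemma no_jump_indep (B : set Omega) :
  sigma_algebra_of_family `[0, +oo[ W B ->
  P (B `&` [set om | inc om = 0%R]) =
  (P B * P [set om | inc om = 0%R])%E.
Proof.
move=> HB; set E := [set om | _].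
have SE : sigma_algebra_of_family `[0, +oo[ N E.
  have mn u : 0 <= u -> @measurable_fun _ _
      (g_sigma_algebraType (\bigcup_(i in `[0, +oo[) sigma_algebra_of (N i))) R setT
      (fun om => (N u om)%:R : R).
    move=> u0; apply: (measurableT_comp (f := fun n : nat => n%:R : R)) => //.
    by apply: measurable_fun_sigma_family; rewrite /= in_itv/= u0.
  apply: (sigma_family_preimage (A := [set 0])
    (f := fun om => (N t' om)%:R - (N t om)%:R : R)) => //.
  by apply: measurable_funB; exact: mn.
have SZ : sigma_algebra_of_family [set: nat] zeta setT by exact: sigma_familyT.
have := drivers_indep Hindep HB SE SZ.
by rewrite setIT probability_setT mule1.
Qed.

(** The random sum [J] mixes two drivers, but on the cell N_t = n, N_t' = n' it is a fixed finite
    combination of the jump sizes. There the event is the intersection of one about N and one about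
    zeta, the independence of the three drivers applies, and the cells are summed in two stages. *)
Lemma jump_event_indep (B : set Omega) (C : set R) :
  sigma_algebra_of_family `[0, +oo[ W B -> measurable C ->
  let E := J @^-1` C `&` [set om | inc om <> 0%R] in
  P (B `&` E) = (P B * P E)%E.
Proof.
move=> HB mC E.
have mB : measurable B by exact: (sigma_family_measurable HB).
(* The diagonal cells are emptied because the event requires a nonzero increment of N. *)
pose H n n' := if n == n' then set0 else
  [set om | N t om = n] `&` [set om | N t' om = n'] `&`
  [set om | C (\sum_(j < n') zeta j om - \sum_(j < n) zeta j om)].
have mH n n' : measurable (H n n').
  rewrite /H; case: ifP => // _; apply: measurableI; last exact: mZ.
  exact: measurableI.
have HP n n' : P (B `&` H n n') = ((fine (P B))%:E * P (H n n'))%E.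
  rewrite fineK ?fin_num_measure//.
  rewrite /H; case: ifP => _; first by rewrite setI0 measure0 mule0.
  set F := [set om | N t om = n] `&` [set om | N t' om = n'].
  set G := [set om | C _].
  have SF : sigma_algebra_of_family `[0, +oo[ N F.
    by apply: (sigma_algebra_setI erefl); exact: counting_event.
  have SG : sigma_algebra_of_family [set: nat] zeta G by exact: jump_sum_event.
  rewrite (drivers_indep Hindep HB SF SG).
  have SW : sigma_algebra_of_family `[0, +oo[ W setT by exact: sigma_familyT.
  have := drivers_indep Hindep SW SF SG.
  by rewrite setTI probability_setT mul1e => ->.
have mU n : measurable (\bigcup_n' H n n') by exact: bigcupT_measurable.
have P1 n : P (B `&` \bigcup_n' H n n') = ((fine (P B))%:E * P (\bigcup_n' H n n'))%E.
  rewrite setI_bigcupr (probability_bigcup_proportional (F := H n) (G := fun=> B) (k := fine (P B)))//.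
  apply/trivIsetP => i j _ _ ij; apply/seteqP; split => // om [].
  rewrite /H; case: ifP => // _ [[_ /= Ni] _]; case: ifP => // _ [[_ /= Nj] _].
  by move: ij; rewrite -Ni Nj eqxx.
have EE : E = \bigcup_n \bigcup_n' H n n'.
  apply/seteqP; split => [om [/= Jo No]|om [n _ [n' _]]].
    exists (N t om) => //; exists (N t' om) => //; rewrite /H; case: ifPn => // /eqP Ne.
    by case: No; rewrite /inc Ne subrr.
  rewrite /H; case: ifPn => // nn' [[/= Nt Nt'] Co]; split => /=.
    by rewrite /J /jump_part Nt Nt'.
  rewrite /inc Nt Nt' => /eqP; rewrite subr_eq0 eqr_nat => /eqP n'n.
  by rewrite n'n eqxx in nn'.
rewrite EE setI_bigcupr (probability_bigcup_proportional
  (F := fun n => \bigcup_n' H n n') (G := fun=> B) (k := fine (P B)))//.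
  by rewrite fineK ?fin_num_measure.
apply/trivIsetP => i j _ _ ij; apply/seteqP; split => // om [[n _ +] [n' _]].
rewrite /H; case: ifP => // _ [[/= Ni _] _]; case: ifP => // _ [[/= Nj _] _].
by move: ij; rewrite -Ni Nj eqxx.
Qed.

(** On the cell N_t = n, N_t' = n + 1, the jump sum is [zeta n], as jumps are numbered from 0; its
    law does not depend on n. *)
Lemma one_jump_law (C : set R) (k : R) : measurable C ->
  (forall j, P (zeta j @^-1` C) = k%:E) ->
  P (J @^-1` C `&` [set om | inc om = 1%R]) =
  (k%:E * P [set om | inc om = 1%R])%E.
Proof.
move=> mC Hk.
pose F n := [set om | N t om = n] `&` [set om | N t' om = n.+1].
pose G n := zeta n @^-1` C.
have mF n : measurable (F n) by exact: measurableI.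
have mG n : measurable (G n).
  by rewrite /G -[X in measurable X]setTI; exact: measurable_funP.
have oneP (a b : nat) : (b%:R - a%:R = 1 :> R) <-> b = a.+1.
  split=> [/eqP|->]; last by rewrite -natr1 addrAC subrr add0r.
  by rewrite subr_eq nat1r eqr_nat => /eqP.
have -> : [set om | inc om = 1%R] = \bigcup_n F n.
  apply/seteqP; split => [om /= /oneP No|om [n _ [/= Nt Nt']]].
    by exists (N t om).
  by apply/oneP; rewrite Nt.
rewrite setI_bigcupr.
transitivity (P (\bigcup_n (G n `&` F n))).
  congr (P _); apply: eq_bigcupr => n _; apply/seteqP.
  split => om [Co [/= Nt Nt']]; (split; last by split); move: Co;
    by rewrite /G /preimage/= /J /jump_part Nt Nt' big_ord_recr/= addrAC subrr add0r.
apply: probability_bigcup_proportional => //.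
  apply/trivIsetP => i j _ _ ij; apply/seteqP; split => // om [[/= Ni _] [/= Nj _]].
  by move: ij; rewrite -Ni Nj eqxx.
move=> n.
have SF : sigma_algebra_of_family `[0, +oo[ N (F n).
  by apply: (sigma_algebra_setI erefl); exact: counting_event.
have SG : sigma_algebra_of_family [set: nat] zeta (G n).
  by apply: sigma_family_preimage => //; exact: measurable_fun_sigma_family.
have SW : sigma_algebra_of_family `[0, +oo[ W setT by exact: sigma_familyT.
have := drivers_indep Hindep SW SF SG.
by rewrite setTI probability_setT mul1e setIC Hk muleC.
Qed.

End jump_events.

(** * Monotonicity of the ratio of the two densities *)

Section hyperbolic.
Context {R : realType}.
Implicit Types x y : R.

(* Twice cosh and twice sinh. *)
Definition ch x := expR x + expR (- x).
Definition sh x := expR x - expR (- x).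

Lemma ch_gt0 x : 0 < ch x. Proof. by rewrite addr_gt0 ?expR_gt0. Qed.

Lemma shN x : sh (- x) = - sh x. Proof. by rewrite /sh opprK opprB. Qed.

Lemma sh_ge0 x : 0 <= x -> 0 <= sh x.
Proof. by move=> x0; rewrite subr_ge0 ler_expR; lra. Qed.

Lemma sh_gt0 x : 0 < x -> 0 < sh x.
Proof. by move=> x0; rewrite subr_gt0 ltr_expR; lra. Qed.

Lemma le_sh x y : x <= y -> sh x <= sh y.
Proof. by move=> xy; rewrite lerB// ler_expR// lerN2. Qed.

(** The left side is the numerator of the increment of cosh(a b) / cosh(m b) from b1 to b2. For 0 <
    b1 < b2 both products on the right have the sign of a^2 - m^2, which displays the monotonicity
    when |a| >= m and measures its failure otherwise. *)
Lemma ch_mul (a m b1 b2 : R) :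
  ch (a * b2) * ch (m * b1) - ch (a * b1) * ch (m * b2) =
  sh ((a + m) * ((b1 + b2) / 2)) * sh ((a - m) * ((b2 - b1) / 2)) +
  sh ((a - m) * ((b1 + b2) / 2)) * sh ((a + m) * ((b2 - b1) / 2)).
Proof.
have prod x y : ch x * ch y = ch (x + y) + ch (x - y).
  rewrite /ch !mulrDl !mulrDr -!expRD !opprD !opprK; ring.
have prods x y : sh x * sh y = ch (x + y) - ch (x - y).
  by rewrite /ch /sh !mulrBl !mulrBr -!expRD !opprD !opprK; ring.
rewrite !prod !prods.
have -> : (a + m) * ((b1 + b2) / 2) + (a - m) * ((b2 - b1) / 2) = a * b2 + m * b1.
  by field.
have -> : (a + m) * ((b1 + b2) / 2) - (a - m) * ((b2 - b1) / 2) = a * b1 + m * b2.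
  by field.
have -> : (a - m) * ((b1 + b2) / 2) + (a + m) * ((b2 - b1) / 2) = a * b2 - m * b1.
  by field.
have -> : (a - m) * ((b1 + b2) / 2) - (a + m) * ((b2 - b1) / 2) = a * b1 - m * b2.
  by field.
ring.
Qed.

(** Convexity of sinh on the half-line together with sinh 0 = 0, proved through the sign of the
    derivative of the difference. Used on both factors of a product of two sinh, it yields the
    square of th. *)
Lemma sh_contract (th x : R) : 0 <= th <= 1 -> 0 <= x ->
  sh (th * x) <= th * sh x.
Proof.
move=> /andP[th0 th1] x0.
pose f t : R := th * sh t - sh (th * t).
pose df t : R := th * ch t - th * ch (th * t).
have fd t : is_derive t (1 : R) f (df t).
  rewrite /f /df /sh /ch; apply: is_derive_eq.
  rewrite /GRing.scale/=; ring.
have dfge0 t : 0 <= t -> 0 <= df t.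
  move=> t0; rewrite /df -mulrBr mulr_ge0// subr_ge0.
  rewrite -subr_ge0 (_ : _ - _ = (expR t - expR (th * t)) *
      (1 - expR (- (th * t + t)))); last first.
    rewrite /ch mulrBr mulr1 mulrBl -!expRD.
    rewrite (_ : t - (th * t + t) = - (th * t)); last by ring.
    rewrite (_ : th * t - (th * t + t) = - t); last by ring.
    by ring.
  apply: mulr_ge0; rewrite subr_ge0 ?ler_expR.
    by rewrite ler_piMl.
  by rewrite -expR0 ler_expR oppr_le0 addr_ge0// mulr_ge0.
have cf : {within `[0, x], continuous f}.
  apply: derivable_within_continuous => y _.
  exact: (@ex_derive _ _ _ _ _ _ _ (fd y)).
have [c /[!in_itv]/= /andP[c0 _] fE] := MVT_segment x0 (fun y _ => fd y) cf.
have : 0 <= f x - f 0 by rewrite fE subr0 mulr_ge0// dfge0.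
by rewrite /f mulr0 /sh oppr0 subrr mulr0 subrr subr0 subr_ge0.
Qed.

End hyperbolic.

(** * Minimum of a function whose derivative changes sign once *)

Section optimum.
Context {R : realType}.
Local Notation mu := (@lebesgue_measure R).

(** A zero integral would make u vanish almost everywhere on an interval of positive length.
    Positivity is asked only strictly inside, because the derivative of the loss may vanish at B^*,
    which occurs as an end point. *)
Lemma Rintegral_gt0 (u : R -> R) (x y : R) : x < y ->
  mu.-integrable `]x, y] (EFin \o u) ->
  (forall b, x < b < y -> 0 < u b) -> 0 < \int[mu]_(b in `]x, y]) u b.
Proof.
move=> xy iu upos.
have mu_ : measurable_fun `]x, y[ (EFin \o u).
  apply: measurable_funS (measurable_int _ iu) => // b /=; rewrite !in_itv/=.
  by move=> /andP[-> /ltW].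
have E : (\int[mu]_(b in `]x, y]) (u b)%:E = \int[mu]_(b in `]x, y[) (u b)%:E)%E.
  apply/esym; apply: integral_itv_bndo_bndc.
  exact: mu_.
have Ifin : (\int[mu]_(b in `]x, y[) (u b)%:E)%E \is a fin_num.
  by rewrite -E; exact: (integrable_fin_num _ iu).
rewrite /Rintegral E lt_neqAle; apply/andP; split; last first.
  apply: fine_ge0; apply: integral_ge0 => b /=; rewrite in_itv/= => /upos ub.
  by rewrite lee_fin ltW.
apply/negP => /eqP /esym /eqP; rewrite fine_eq0// => /eqP I0.
have I1 : (\int[mu]_(b in `]x, y[) `|(EFin \o u) b|)%E = 0%E.
  rewrite -I0; apply: eq_integral => b; rewrite inE/= in_itv/= => /upos ub.
  by rewrite gtr0_norm.
have [+ _] := @ae_eq_integral_abs _ _ _ mu `]x, y[ (measurable_itv _) (EFin \o u) mu_.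
move=> /(_ I1)[N [mN N0 sN]].
have : (mu `]x, y[%classic <= 0)%E.
  rewrite -N0; apply: le_measure; rewrite ?inE// => b bxy; apply: sN => /= /(_ bxy).
  move: bxy; rewrite /= in_itv/= => /upos ub [] u0; by rewrite u0 ltxx in ub.
by rewrite lebesgue_measure_itv/= lte_fin xy -EFinB lee_fin subr_le0 leNgt xy.
Qed.

(* L is an antiderivative of w g_J - q g_D; since g_J / g_D is increasing, this
   derivative changes sign once, at B^* = sup {b : w g_J(b) <= q g_D(b)}. *)
Lemma unique_minimum_of_monotone_ratio (gD gJ L : R -> R) (c0 q w : R) :
  0 < w -> 0 <= q ->
  (forall B, 0 <= B -> mu.-integrable `]0, B] (EFin \o gD)) ->
  (forall B, 0 <= B -> mu.-integrable `]0, B] (EFin \o gJ)) ->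
  (forall b, 0 < b -> 0 < gD b) ->
  (forall b1 b2, 0 < b1 -> b1 < b2 -> gJ b1 * gD b2 < gJ b2 * gD b1) ->
  (forall K, exists2 b, 0 < b & K * gD b < gJ b) ->
  (forall B, 0 <= B -> L B = c0 + w * (\int[mu]_(b in `]0, B]) gJ b) -
     q * (\int[mu]_(b in `]0, B]) gD b)) ->
  quasi_convex_on `[0, +oo[ L /\ exists! B : R, global_min_on `[0, +oo[ L B.
Proof.
move=> w0 q0 igD igJ gD0 ratio grow LE.
pose u b := w * gJ b - q * gD b.
have iu B : 0 <= B -> mu.-integrable `]0, B] (EFin \o u).
  move=> B0; apply: eq_integrable (integrableB _ (integrableZl _ w (igJ B B0))
    (integrableZl _ q (igD B B0))) => //.
have LB x y : 0 <= x -> x <= y -> L y - L x = \int[mu]_(b in `]x, y]) u b.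
  move=> x0 xy; have y0 := le_trans x0 xy.
  have LE' B : 0 <= B -> L B = c0 + \int[mu]_(b in `]0, B]) u b.
    move=> B0; rewrite LE// -addrA; congr (_ + _).
    rewrite RintegralB//; last 2 first.
    - exact: eq_integrable (integrableZl _ w (igJ B B0)).
    - exact: eq_integrable (integrableZl _ q (igD B B0)).
    rewrite RintegralZl//; last exact: igJ.
    by rewrite RintegralZl//; exact: igD.
  rewrite !LE' // opprD addrACA subrr add0r Rintegral_itvB ?bnd_simp//.
  exact: iu.
have iuS x y : 0 <= x -> x <= y -> mu.-integrable `]x, y] (EFin \o u).
  move=> x0 xy; apply: integrableS (iu y (le_trans x0 xy)) => // b /=.
  by rewrite !in_itv/= => /andP[xb ->]; rewrite andbT (le_lt_trans x0).
have uneg b1 b2 : 0 < b1 -> b1 < b2 -> u b2 <= 0 -> u b1 < 0.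
  rewrite /u => b10 b12 ub2.
  have D1 := gD0 _ b10; have D2 := gD0 _ (lt_trans b10 b12).
  have r := ratio _ _ b10 b12.
  have h1 : w * (gJ b1 * gD b2) < w * (gJ b2 * gD b1) by rewrite ltr_pM2l.
  have h2 : w * gJ b2 * gD b1 <= q * gD b2 * gD b1.
    by rewrite ler_pM2r// -subr_le0.
  rewrite subr_lt0 -(ltr_pM2r D2) [ltRHS]mulrAC; apply: lt_le_trans h2.
  by rewrite -!mulrA.
(* The point 0 makes the set nonempty; the supremum is 0 when [u] is positive on the whole of ]0,
   +oo[. *)
pose S : set R := [set b | b = 0 \/ (0 < b /\ u b <= 0)].
have [bm bm0 ubm] : exists2 b, 0 < b & 0 < u b.
  have [b b0 h] := grow (q / w); exists b => //.
  have := h; rewrite -(ltr_pM2l w0) mulrA [w * _]mulrC divfK ?gt_eqF//.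
  by rewrite -subr_gt0.
have Sub : ubound S bm.
  move=> b [->|[b0 ub]]; first exact: ltW.
  rewrite leNgt; apply/negP => bmb.
  by have := uneg _ _ bm0 bmb ub; rewrite ltNge (ltW ubm).
have hS : has_sup S by split; [exists 0; left|exists bm].
pose Bs := sup S.
have Bs0 : 0 <= Bs by apply: ub_le_sup; [exists bm|left].
have lo b : 0 < b -> b < Bs -> u b < 0.
  move=> b0 bBs.
  have [b' Sb' bb'] : exists2 b', S b' & b < b'.
    have e0 : 0 < Bs - b by rewrite subr_gt0.
    by have [b' Sb'] := sup_adherent e0 hS; rewrite subKr; exists b'.
  case: Sb' bb' => [->|[b'0 ub'] bb']; first by move=> /(lt_trans b0); rewrite ltxx.
  exact: (uneg _ _ b0 bb' ub').
have hi b : Bs < b -> 0 < u b.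
  move=> Bsb; rewrite ltNge; apply/negP => ub.
  have : b <= Bs by apply: ub_le_sup; [exists bm|right; split => //; exact: le_lt_trans Bsb].
  by rewrite leNgt Bsb.
have decr x y : 0 <= x -> x < y -> y <= Bs -> L y < L x.
  move=> x0 xy yB; rewrite -subr_lt0 LB ?(ltW xy)//.
  rewrite -oppr_gt0 -mulN1r -RintegralZl ?(iuS _ _ x0 (ltW xy))//.
  apply: Rintegral_gt0 => //.
    by apply: eq_integrable (integrableZl _ (-1) (iuS _ _ x0 (ltW xy))).
  move=> b /andP[xb yb]; rewrite mulN1r oppr_gt0; apply: lo.
    exact: le_lt_trans xb.
  exact: lt_le_trans yB.
have incr x y : Bs <= x -> x < y -> L x < L y.
  move=> Bx xy; have x0 := le_trans Bs0 Bx.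
  rewrite -subr_gt0 LB ?(ltW xy)//; apply: Rintegral_gt0 => //.
    exact: iuS (ltW xy).
  by move=> b /andP[xb _]; apply: hi; exact: le_lt_trans xb.
have min B : 0 <= B -> B != Bs -> L Bs < L B.
  move=> B0; case: (ltgtP B Bs) => // BB _; [exact: decr|exact: incr].
split; last first.
  exists Bs; split.
    split; first by rewrite /= in_itv/= andbT.
    move=> y; rewrite /= in_itv/= andbT => y0.
    by have [->//|yB] := eqVneq y Bs; apply: ltW; exact: min.
  move=> B [+ HB]; rewrite /= in_itv/= andbT => B0.
  apply/eqP; apply: contraT; rewrite eq_sym => /(min _ B0).
  by rewrite ltNge HB//= in_itv/= andbT.
move=> x y th; rewrite /= !in_itv/= !andbT => x0 y0 /andP[th0 th1].
wlog xy : x y th x0 y0 th0 th1 / x <= y.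
  move=> H; have [xy|/ltW yx] := leP x y; first exact: H.
  have := H y x (1 - th) y0 x0; rewrite subr_ge0 gerBl subKr addrC maxC.
  by apply.
set z := _ + _.
have th1' : 0 <= 1 - th by rewrite subr_ge0.
have xz : x <= z.
  rewrite -subr_ge0 (_ : z - x = (1 - th) * (y - x)); first by rewrite mulr_ge0// subr_ge0.
  by rewrite /z; ring.
have zy : z <= y.
  rewrite -subr_ge0 (_ : y - z = th * (y - x)); first by rewrite mulr_ge0// subr_ge0.
  by rewrite /z; ring.
have [zB|zB] := leP z Bs.
  rewrite le_max; apply/orP; left.
  move: xz; rewrite le_eqVlt => /predU1P[->//|xz]; apply: ltW; exact: decr.
rewrite le_max; apply/orP; right.
move: zy; rewrite le_eqVlt => /predU1P[->//|zy]; apply: ltW; apply: incr => //.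
exact: ltW.
Qed.

End optimum.

(** * Densities of absolute values of normal variables *)

Section reflected_integral.
Context {R : realType}.
Local Notation mu := (@lebesgue_measure R).

(** The interval [- B - a, B - a] is cut at - a and each half is parametrised by b = |a + x|: x = b
    - a on the right, x = - b - a on the left. *)
Lemma ge0_integral_reflect (f : R -> \bar R) (a B : R) : 0 <= B ->
  measurable_fun [set: R] f -> (forall x, (0 <= f x)%E) ->
  (\int[mu]_(x in [set x | (`|a + x| <= B)%R]) f x =
   \int[mu]_(b in `]0%R, B]) (f (b - a)%R + f (- b - a)%R))%E.
Proof.
move=> B0 mf f0.
have mfA A : measurable_fun A f by exact: measurable_funTS.
have mf1 (A : set R) : measurable_fun A (fun b => f (b - a)).
  apply: measurable_funTS; apply: (measurableT_comp mf).
  exact: measurable_funB.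
have mf2 (A : set R) : measurable_fun A (fun b => f (- b - a)).
  apply: measurable_funTS; apply: (measurableT_comp mf).
  exact: measurable_funB.
rewrite (_ : [set x | _] = `[- B - a, - a] `|` `]- a, B - a]); last first.
  rewrite -itv_bndbnd_setU ?bnd_simp; [|lra|lra].
  by apply/seteqP; split => x /=; rewrite in_itv/= ler_norml => /andP[? ?];
    apply/andP; split; lra.
have dj : [disjoint `[(- B - a), (- a)]%classic & `](- a), (B - a)]%classic].
  apply/disj_set2P; apply/seteqP; split => // x [] /=; rewrite !in_itv/=.
  by move=> /andP[_ xa] /andP[ax _]; rewrite ltNge xa in ax.
rewrite (@ge0_integral_setU _ _ _ mu _ _ (measurable_itv _) (measurable_itv _) f
  (mfA _) (fun x _ => f0 x) dj).
have N1 : (-1 : R) != 0 by rewrite oppr_eq0 oner_eq0.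
have N2 : (1 : R) != 0 by exact: oner_neq0.
have E1 : (\int[mu]_(x in `[(- B - a)%R, (- a)%R]) f x =
    \int[mu]_(b in `]0%R, B]) f (- b - a)%R)%E.
  rewrite (ge0_integral_affine (- a) N1 (measurable_itv _) (mfA _) f0).
  rewrite normrN1 mul1e (_ : _ @^-1` _ = `[0, B]%classic); last first.
    by apply/seteqP; split => x /=; rewrite !in_itv/= => /andP[? ?]; apply/andP; split; lra.
  rewrite -integral_itv_obnd_cbnd; first by apply: eq_integral => b _; rewrite mulN1r.
  by apply: eq_measurable_fun (mf2 _) => b _; rewrite mulN1r.
have E2 : (\int[mu]_(x in `](- a)%R, (B - a)%R]) f x =
    \int[mu]_(b in `]0%R, B]) f (b - a)%R)%E.
  rewrite (ge0_integral_affine (- a) N2 (measurable_itv _) (mfA _) f0).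
  rewrite normr1 mul1e (_ : _ @^-1` _ = `]0, B]%classic); last first.
    by apply/seteqP; split => x /=; rewrite !in_itv/= => /andP[? ?]; apply/andP; split; lra.
  by apply: eq_integral => b _; rewrite mul1r.
apply: etrans (congr2 _ E1 E2) _.
rewrite addeC; apply/esym.
exact: (ge0_integralD mu (measurable_itv _) (fun x _ => f0 _) (mf1 _)
  (fun x _ => f0 _) (mf2 _)).
Qed.

End reflected_integral.

Section kernel.
Context {R : realType}.
Local Notation mu := (@lebesgue_measure R).
Variable s : R.
Hypothesis s0 : 0 < s.

(* The density at b >= 0 of the absolute value of a normal variable of mean a. *)
Definition folded_pdf (a b : R) : R := normal_pdf 0 s (b - a) + normal_pdf 0 s (b + a).

(** Expanding the squares separates a factor in b alone, which cancels in the ratio of densities, a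
    factor in a alone, and the hyperbolic cosine that couples them. *)
Lemma folded_pdfE (a b : R) : folded_pdf a b =
  normal_peak 1 / s * expR (- b ^+ 2 / (2 * s ^+ 2)) *
  (expR (- a ^+ 2 / (2 * s ^+ 2)) * ch (a * (b / s ^+ 2))).
Proof.
rewrite /folded_pdf !normal_pdf0E// -mulrDr -!mulrA /ch; congr (_ * (_ * _)).
rewrite !mulrDr -!expRD; congr (expR _ + expR _); field;
  by rewrite gt_eqF.
Qed.

Lemma folded_pdf_gt0 (a b : R) : 0 < folded_pdf a b.
Proof.
rewrite folded_pdfE; apply: mulr_gt0; last by rewrite mulr_gt0 ?expR_gt0 ?ch_gt0.
by rewrite mulr_gt0 ?expR_gt0// divr_gt0// normal_peak_gt0 ?oner_eq0.
Qed.

Lemma folded_pdf_ub (a b : R) : folded_pdf a b <= normal_peak s + normal_peak s.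
Proof. by rewrite lerD// normal_pdf_ub// gt_eqF. Qed.

Lemma measurable_folded_pdf (a : R) : measurable_fun [set: R] (folded_pdf a).
Proof.
apply: measurable_funD; apply: (measurableT_comp (measurable_normal_pdf 0 s)).
  exact: measurable_funB.
exact: measurable_funD.
Qed.

Lemma measurable_folded_pdf_shift (m b : R) :
  measurable_fun [set: R] (fun y => folded_pdf (m + y) b).
Proof.
apply: measurable_funD; apply: (measurableT_comp (measurable_normal_pdf 0 s)).
  by apply: measurable_funB => //; exact: measurable_funD.
by apply: measurable_funD => //; exact: measurable_funD.
Qed.

Lemma normal_prob_folded (a B : R) : 0 <= B ->
  normal_prob 0 s [set x | `|a + x| <= B] =
  (\int[mu]_(b in `]0%R, B]) (folded_pdf a b)%:E)%E.
Proof.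
move=> B0.
have mp : measurable_fun [set: R] (fun x => (normal_pdf 0 s x)%:E).
  by apply/measurable_EFinP; exact: measurable_normal_pdf.
have p0 x : (0 <= (normal_pdf 0 s x)%:E)%E by rewrite lee_fin normal_pdf_ge0.
apply: etrans (ge0_integral_reflect a B0 mp p0) _.
apply: eq_integral => b _; rewrite /folded_pdf EFinD; congr (_ + _%:E)%E.
have -> : - b - a = - (b + a) by rewrite opprD.
by rewrite (normal_pdf0E (- (b + a)) s0) (normal_pdf0E (b + a) s0) [- (b + a) / s]mulNr sqrrN.
Qed.

End kernel.

(** * Gain and loss in the density ratio *)

Section ratio.
Context {R : realType}.
Variables (s m : R) (nu : {finite_measure set R -> \bar R}) (A0 : set R).
Hypotheses (s0 : 0 < s) (m0 : 0 <= m) (ms : 3 * m <= s) (mA0 : measurable A0).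
Hypothesis HA0 : forall y, A0 y -> s <= `|m + y| <= 2 * s.
(** Here s - m is a lower bound of |a + m| and |a - m| when |a| >= s, and 3 m <= s amounts to th <=
    1. In [nuA0], the loss th^2 is charged to the whole mass and the gain is counted on A0 only,
    with exp(- 2) the least value of exp(- a^2 / (2 s^2)) for |a| <= 2 s. *)
Let th := 2 * m / (s - m).
Hypothesis nuA0 : th ^+ 2 * fine (nu setT) < expR (- 2) * fine (nu A0).

Let r0 : 0 < s - m.
Proof. by move: s0 m0 ms; lra. Qed.

Let th0 : 0 <= th. Proof. by rewrite /th divr_ge0 ?mulr_ge0// ltW. Qed.

Let th1 : th <= 1.
Proof. by rewrite /th ler_pdivrMr// mul1r; move: ms; lra. Qed.

Let bracket (a u v : R) :=
  sh ((a + m) * u) * sh ((a - m) * v) + sh ((a - m) * u) * sh ((a + m) * v).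

(* For |a| < m both |a + m| and |a - m| are at most 2 m = th (s - m). *)
Lemma bracket_bounds (a u v : R) : 0 <= u -> 0 <= v ->
  - (th ^+ 2 * (2 * (sh ((s - m) * u) * sh ((s - m) * v)))) <= bracket a u v /\
  (s <= `|a| -> 2 * (sh ((s - m) * u) * sh ((s - m) * v)) <= bracket a u v).
Proof.
move=> u0 v0; move: (s0) (m0) (ms) => s0' m0' ms'.
wlog a0 : a / 0 <= a.
  move=> H; have [/H//|/ltW a0] := leP 0 a.
  have <- : bracket (- a) u v = bracket a u v.
    rewrite /bracket (_ : (- a + m) * u = - ((a - m) * u)); last by ring.
    rewrite (_ : (- a - m) * v = - ((a + m) * v)); last by ring.
    rewrite (_ : (- a - m) * u = - ((a + m) * u)); last by ring.
    rewrite (_ : (- a + m) * v = - ((a - m) * v)); last by ring.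
    by rewrite !shN !mulrNN addrC.
  by rewrite -normrN; apply: H; rewrite oppr_ge0.
rewrite /bracket.
have shr w : 0 <= w -> 0 <= sh ((s - m) * w).
  by move=> w0; rewrite sh_ge0// mulr_ge0// ltW.
have [am|am] := leP m a.
  have p1 w : 0 <= w -> 0 <= sh ((a + m) * w).
    by move=> w0; rewrite sh_ge0// mulr_ge0//; lra.
  have p2 w : 0 <= w -> 0 <= sh ((a - m) * w).
    by move=> w0; rewrite sh_ge0// mulr_ge0//; lra.
  split=> [|sa].
    apply: (@le_trans _ _ 0).
      rewrite oppr_le0; apply: mulr_ge0; first exact: sqr_ge0.
      by apply: mulr_ge0; [exact: ler0n|apply: mulr_ge0; exact: shr].
    by apply: addr_ge0; apply: mulr_ge0; [exact: p1|exact: p2|exact: p2|exact: p1].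
  have sa' : s <= a by rewrite -(ger0_norm a0).
  have q1 w : 0 <= w -> sh ((s - m) * w) <= sh ((a + m) * w).
    by move=> w0; apply: le_sh; apply: ler_wpM2r => //; lra.
  have q2 w : 0 <= w -> sh ((s - m) * w) <= sh ((a - m) * w).
    by move=> w0; apply: le_sh; apply: ler_wpM2r => //; lra.
  rewrite mulr_natl mulr2n; apply: lerD; apply: ler_pM;
    by [exact: shr|exact: q1|exact: q2].
split; last by rewrite ger0_norm// => sa; lra.
have bnd c w : 0 <= w -> `|c| <= 2 * m -> `|sh (c * w)| <= th * sh ((s - m) * w).
  move=> w0 cm.
  have thw : th * ((s - m) * w) = 2 * m * w.
    by rewrite /th mulrA divfK// gt_eqF.
  apply: (@le_trans _ _ (sh (th * ((s - m) * w)))); last first.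
    apply: sh_contract; first by rewrite th0 th1.
    by apply: mulr_ge0 => //; exact: ltW.
  move: cm; rewrite thw !ler_norml => /andP[c1 c2]; rewrite -shN.
  apply/andP; split; apply: le_sh; first by rewrite -mulNr; exact: ler_wpM2r.
  exact: ler_wpM2r.
have n1 : `|a + m| <= 2 * m by rewrite ger0_norm; lra.
have n2 : `|a - m| <= 2 * m by rewrite ler_norml; apply/andP; split; lra.
rewrite lerNl; apply: le_trans (ler_norm _) _; rewrite normrN.
apply: le_trans (ler_normD _ _) _; rewrite !normrM.
have q c1 c2 : `|c1| <= 2 * m -> `|c2| <= 2 * m ->
    `|sh (c1 * u)| * `|sh (c2 * v)| <=
    th * sh ((s - m) * u) * (th * sh ((s - m) * v)).
  move=> h1 h2; apply: ler_pM; [exact: normr_ge0|exact: normr_ge0| |].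
    exact: bnd.
  exact: bnd.
apply: le_trans (lerD (q _ _ n1 n2) (q _ _ n2 n1)) _.
rewrite le_eqVlt; apply/orP; left; apply/eqP; ring.
Qed.

Let gJ b := \int[nu]_y folded_pdf s (m + y) b.
Let gD b := folded_pdf s m b.

Lemma integrable_folded_pdf (b : R) :
  nu.-integrable [set: R] (fun y => (folded_pdf s (m + y) b)%:E).
Proof.
apply: measurable_bounded_integrable => //.
- by rewrite -ge0_fin_numE// fin_num_measure.
- exact: measurable_folded_pdf_shift.
exists (normal_peak s + normal_peak s); split; first exact: num_real.
move=> M Mp y _; rewrite /= ger0_norm; last exact/ltW/folded_pdf_gt0.
exact: le_trans (folded_pdf_ub s0 _ _) (ltW Mp).
Qed.

Let nuA0_fin : nu A0 \is a fin_num. Proof. exact: fin_num_measure. Qed.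

(** Apart from a factor C common to all y, the contribution of y to the difference is exp(- (m +
    y)^2 / (2 s^2)) times the bracket. The exponential is at most 1, and at least exp(- 2) on A0;
    the bracket is at least - th^2 G, and at least G on A0. Integrating this lower bound gives C G
    times a quantity that [nuA0] makes positive. *)
Lemma mixture_ratio_increasing (b1 b2 : R) : 0 < b1 -> b1 < b2 ->
  gJ b1 * gD b2 < gJ b2 * gD b1.
Proof.
move=> b10 b12; have v0 : 0 < s ^+ 2 by rewrite exprn_gt0.
pose u := (b1 / s ^+ 2 + b2 / s ^+ 2) / 2.
pose w := (b2 / s ^+ 2 - b1 / s ^+ 2) / 2.
have u0 : 0 < u by rewrite divr_gt0// addr_gt0// divr_gt0//; exact: lt_trans b12.
have w0 : 0 < w by rewrite divr_gt0// subr_gt0 ltr_pM2r// invr_gt0.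
pose G := 2 * (sh ((s - m) * u) * sh ((s - m) * w)).
have G0 : 0 < G by rewrite !mulr_gt0// sh_gt0// mulr_gt0.
pose E x := expR (- x ^+ 2 / (2 * s ^+ 2)).
pose C := (normal_peak 1 / s) ^+ 2 * E b1 * E b2 * E m.
have pk0 : 0 < normal_peak 1 / s.
  by apply: divr_gt0 => //; apply: normal_peak_gt0; exact: oner_neq0.
have C0 : 0 < C.
  by rewrite /C; do 3?[apply: mulr_gt0; last exact: expR_gt0]; exact: exprn_gt0.
have int1 := integrable_folded_pdf b1; have int2 := integrable_folded_pdf b2.
have iZ (b c : R) : nu.-integrable setT
    (EFin \o (fun y => folded_pdf s (m + y) b * c)).
  by apply: eq_integrable (integrableZr _ c (integrable_folded_pdf b)).
rewrite -subr_gt0 /gJ -!RintegralZr//.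
rewrite -RintegralB//.
have iI : nu.-integrable setT (EFin \o (fun y => \1_A0 y : R)).
  by apply: integrable_indic => //; rewrite -ge0_fin_numE.
have iG : nu.-integrable setT (EFin \o (fun y =>
    C * G * expR (- 2) * \1_A0 y - C * G * th ^+ 2)).
  apply: eq_integrable (integrableB _ (integrableZl _ (C * G * expR (- 2)) iI)
    (finite_measure_integrable_cst nu (C * G * th ^+ 2) measurableT)) => //.
apply: (@lt_le_trans _ _ (\int[nu]_y (C * G * expR (- 2) * \1_A0 y - C * G * th ^+ 2))).
  rewrite RintegralB//; last 2 first.
  - exact: eq_integrable (integrableZl _ (C * G * expR (- 2)) iI).
  - exact: finite_measure_integrable_cst.
  rewrite RintegralZl// Rintegral_cst// /Rintegral integral_indic// setIT.
  rewrite (_ : _ - _ = C * G *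
    (expR (- 2) * fine (nu A0) - th ^+ 2 * fine (nu setT))); last by ring.
  by apply: mulr_gt0; [exact: mulr_gt0|rewrite subr_gt0].
apply: le_Rintegral => //.
  apply: eq_integrable (integrableB _ (iZ b2 (gD b1)) (iZ b1 (gD b2))) => //.
move=> y _; rewrite /gD !folded_pdfE//.
rewrite -/(E b1) -/(E b2) -/(E m) -/(E (m + y)).
rewrite [leRHS](_ : _ = C * (E (m + y) *
    (ch ((m + y) * (b2 / s ^+ 2)) * ch (m * (b1 / s ^+ 2)) -
     ch ((m + y) * (b1 / s ^+ 2)) * ch (m * (b2 / s ^+ 2))))); last first.
  by rewrite /C; ring.
rewrite ch_mul -/u -/w -/(bracket (m + y) u w).
have [lb1 lb2] := bracket_bounds (m + y) (ltW u0) (ltW w0).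
move: lb1 lb2; set br := bracket _ _ _ => lb1 lb2.
rewrite [leLHS](_ : _ = C * (G * expR (- 2) * \1_A0 y - G * th ^+ 2)); last by ring.
rewrite (ler_pM2l C0).
have E1 : E (m + y) <= 1.
  by rewrite -expR0 ler_expR mulNr oppr_le0 divr_ge0 ?sqr_ge0// mulr_ge0// ltW.
have E0 : 0 < E (m + y) by exact: expR_gt0.
have [Ay|nAy] := boolP (y \in A0); last first.
  rewrite indicE (negbTE nAy) !mulr0 sub0r.
  have [br0|br0] := leP 0 br.
    apply: (@le_trans _ _ 0); last by apply: mulr_ge0 => //; exact: ltW.
    by rewrite oppr_le0; apply: mulr_ge0; [exact: ltW|exact: sqr_ge0].
  apply: (@le_trans _ _ br); first by rewrite mulrC.
  by rewrite ler_nMl.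
rewrite indicE Ay mulr1.
have /HA0/andP[sy y2] := set_mem Ay.
apply: (@le_trans _ _ (G * expR (- 2))).
  by rewrite gerBl; apply: mulr_ge0; [exact: ltW|exact: sqr_ge0].
rewrite mulrC ler_pM ?expR_ge0 ?(ltW G0)//; last exact: lb2.
rewrite /E ler_expR mulNr lerN2 ler_pdivrMr ?mulr_gt0//.
rewrite [leRHS](_ : _ = (2 * s) ^+ 2); last by ring.
by rewrite -[leLHS]real_normK ?num_real// ler_sqr ?nnegrE// ltW// mulr_gt0.
Qed.

(** The set A0 has positive mass by [nuA0], and on it |m + y| >= s > m, so the ratio grows at least
    like exp((s - m) b / s^2). *)
Lemma mixture_ratio_unbounded (K : R) : exists2 b, 0 < b & K * gD b < gJ b.
Proof.
have a0 : 0 < fine (nu A0).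
  rewrite -(pmulr_rgt0 _ (expR_gt0 (- 2))); apply: le_lt_trans nuA0.
  by rewrite mulr_ge0 ?sqr_ge0// fine_ge0.
have v0 : 0 < s ^+ 2 by rewrite exprn_gt0.
pose c := expR (- 2) * fine (nu A0).
have c0 : 0 < c by rewrite mulr_gt0 ?expR_gt0.
pose X := 2 * `|K| / c.
have X0 : 0 <= X by rewrite divr_ge0 ?(ltW c0)// mulr_ge0.
(* Makes the exponent (s - m) b / s^2 equal to X + 1, and exp(X + 1) > X = 2 |K| / c. *)
pose b := s ^+ 2 / (s - m) * (X + 1).
have b0 : 0 < b by rewrite mulr_gt0 ?divr_gt0// ltr_wpDl.
exists b => //.
pose E x := expR (- x ^+ 2 / (2 * s ^+ 2)).
pose D := normal_peak 1 / s * E b.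
have D0 : 0 < D.
  apply: mulr_gt0; last exact: expR_gt0.
  by apply: divr_gt0 => //; apply: normal_peak_gt0; exact: oner_neq0.
have lo : D * (expR (s * (b / s ^+ 2)) * c) <= gJ b.
  have iI : nu.-integrable setT (EFin \o (fun y => \1_A0 y : R)).
    by apply: integrable_indic => //; rewrite -ge0_fin_numE.
  apply: (@le_trans _ _ (\int[nu]_y (D * expR (s * (b / s ^+ 2)) * expR (- 2) * \1_A0 y))).
    rewrite RintegralZl// /Rintegral integral_indic// setIT /c.
    by rewrite !mulrA.
  apply: le_Rintegral => //.
  - exact: eq_integrable (integrableZl _ _ iI).
  - exact: integrable_folded_pdf.
  move=> y _; rewrite indicE; have [Ay|nAy] := boolP (y \in A0); last first.
    by rewrite mulr0 ltW// folded_pdf_gt0.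
  rewrite mulr1 folded_pdfE// -/(E b) -/(E (m + y)) -/D -mulrA ler_pM2l// mulrC.
  have /HA0/andP[sy y2] := set_mem Ay.
  apply: ler_pM; rewrite ?expR_ge0//.
    rewrite /E ler_expR mulNr lerN2 ler_pdivrMr ?mulr_gt0//.
    rewrite [leRHS](_ : _ = (2 * s) ^+ 2); last by ring.
    by rewrite -[leLHS]real_normK ?num_real// ler_sqr ?nnegrE// ltW// mulr_gt0.
  have bs0 : 0 <= b / s ^+ 2 by rewrite ltW// divr_gt0.
  apply: (@le_trans _ _ (expR (`|m + y| * (b / s ^+ 2)))).
    by rewrite ler_expR ler_wpM2r.
  have [my0|my0] := leP 0 (m + y).
    by rewrite ger0_norm// /ch lerDl expR_ge0.
  by rewrite ltr0_norm// /ch mulNr lerDr expR_ge0.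
apply: lt_le_trans lo.
rewrite /gD folded_pdfE// -/(E b) -/(E m) -/D mulrCA ltr_pM2l//.
pose e := expR (m * (b / s ^+ 2)).
have e1 : 1 <= e.
  by rewrite -expR0 ler_expR mulr_ge0// ltW// divr_gt0.
have che : ch (m * (b / s ^+ 2)) <= 2 * e.
  rewrite /ch mulr_natl mulr2n lerD2l ler_expR.
  by rewrite ge0_cp// mulr_ge0// ltW// divr_gt0.
have Em : E m <= 1.
  by rewrite -expR0 ler_expR mulNr oppr_le0 divr_ge0 ?sqr_ge0// mulr_ge0// ltW.
have se : expR (s * (b / s ^+ 2)) = expR (X + 1) * e.
  rewrite -expRD /b; congr expR; field.
  by rewrite !gt_eqF.
have X1 : X < expR (X + 1).
  apply: lt_le_trans (expR_ge1Dx _); lra.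
apply: (@le_lt_trans _ _ (`|K| * (2 * e))).
  apply: (@le_trans _ _ (`|K| * (E m * ch (m * (b / s ^+ 2))))).
    by rewrite ler_wpM2r ?ler_norm// mulr_ge0 ?expR_ge0// ltW// ch_gt0.
  rewrite ler_wpM2l//; apply: le_trans che.
  by rewrite ler_piMl// ltW// ch_gt0.
rewrite se mulrA [ltRHS]mulrAC ltr_pM2r; last exact: lt_le_trans e1.
by rewrite -ltr_pdivrMr// [_ * 2]mulrC.
Qed.

End ratio.

Section threshold.
Context {R : realType}.
Local Notation mu := (@lebesgue_measure R).

(** Passage from probabilities to densities: Tonelli exchanges the mixture over the jump sums with
    the integral over ]0, B], and the bounded densities together with the finite mass of nu give
    integrability. *)
Lemma threshold_loss_unique_minimum (s m q w : R)
    (nu : {finite_measure set R -> \bar R}) (A0 : set R) (L : R -> R) :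
  0 < s -> 0 <= m -> 3 * m <= s -> measurable A0 ->
  (forall y, A0 y -> s <= `|m + y| <= 2 * s) ->
  (2 * m / (s - m)) ^+ 2 * fine (nu setT) < expR (- 2) * fine (nu A0) ->
  0 <= q -> 0 < w ->
  (forall B, 0 <= B ->
    L B = q * fine (normal_prob 0 s [set x | B < `|m + x|]) +
      w * fine (\int[nu]_y normal_prob 0 s [set x | (`|m + y + x| <= B)%R])%E) ->
  quasi_convex_on `[0, +oo[ L /\ exists! B : R, global_min_on `[0, +oo[ L B.
Proof.
move=> s0 m0 ms mA0 HA0 nuA0 q0 w0 LE.
pose gD b := folded_pdf s m b.
pose gJ b := \int[nu]_y folded_pdf s (m + y) b.
pose k (z : R * measurableTypeR R) := (folded_pdf s (m + z.1) z.2)%:E.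
have mk : measurable_fun [set: R * measurableTypeR R] k.
  apply/measurable_EFinP.
  have m1 : measurable_fun [set: R * measurableTypeR R]
      (fun z : R * measurableTypeR R => m + z.1).
    by apply: measurable_funD => //; exact: measurable_fst.
  have m2 : measurable_fun [set: R * measurableTypeR R]
      (fun z : R * measurableTypeR R => z.2 : R) by exact: measurable_snd.
  apply: measurable_funD; apply: (measurableT_comp (measurable_normal_pdf 0 s)).
    exact: measurable_funB.
  exact: measurable_funD.
have k0 z : (0 <= k z)%E by rewrite lee_fin ltW// folded_pdf_gt0.
have gJE b : (gJ b)%:E = (\int[nu]_y k (y, b))%E.
  rewrite /gJ /Rintegral fineK//.
  exact: (integrable_fin_num measurableT (integrable_folded_pdf m nu s0 b)).
have mgJ : measurable_fun [set: measurableTypeR R] (fun b => (gJ b)%:E).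
  have := @measurable_fun_fubini_tonelli_G _ _ R (measurableTypeR R) R nu k mk k0.
  by apply: eq_measurable_fun => b _; rewrite gJE.
have tonelli (B : R) : 0 <= B ->
    (\int[mu]_(b in `]0%R, B]) (gJ b)%:E =
     \int[nu]_y normal_prob 0 s [set x | (`|m + y + x| <= B)%R])%E.
  move=> B0.
  pose f (z : R * measurableTypeR R) : \bar R := (k z * (\1_`]0%R, B] z.2)%:E)%E.
  have mf : measurable_fun setT f.
    apply: emeasurable_funM => //; apply/measurable_EFinP.
    have mi : measurable_fun [set: measurableTypeR R] (\1_`]0, B] : R -> R) by [].
    exact: (measurableT_comp mi measurable_snd).
  have f0 z : (0 <= f z)%E by rewrite mule_ge0// lee_fin.
  have := @fubini_tonelli _ _ R (measurableTypeR R) R nu mu f mf f0.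
  have E1 y : (\int[mu]_b f (y, b) = normal_prob 0 s [set x | (`|m + y + x| <= B)%R])%E.
    rewrite (normal_prob_folded s0 (m + y) B0) [RHS]integral_mkcond.
    apply: eq_integral => b _; rewrite patchE /f/= indicE.
    by case: ifP; rewrite ?mule1 ?mule0.
  have E2 b : (\int[nu]_y f (y, b) = ((fun b => (gJ b)%:E) \_ `]0%R, B]) b)%E.
    rewrite patchE /f/= indicE; case: ifP => _.
      by rewrite gJE; apply: eq_integral => y _; rewrite mule1.
    by apply: integral0_eq => y _; rewrite mule0.
  under eq_integral do rewrite E1.
  move=> ->; rewrite integral_mkcond; apply: eq_integral => b _.
  by rewrite E2.
have mN : measurable_fun setT (fun x : R => `|x|) by exact: normr_measurable.
have mS (y B : R) : measurable [set x : R | `|y + x| <= B].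
  rewrite -[X in measurable X]setTI.
  have : measurable_fun [set: R] (fun x : R => `|y + x|).
    by apply: measurableT_comp => //; exact: measurable_funD.
  move=> /(_ measurableT `]-oo, B]%classic) /(_ (measurable_itv _)).
  by congr measurable; apply/seteqP; split => x /=; rewrite in_itv.
have le1 (y B : R) : (normal_prob 0 s [set x | (`|y + x| <= B)%R] <= 1)%E.
  by apply: (@probability_le1 _ _ R (normal_prob 0 s)); exact: mS.
have tfin (B : R) : 0 <= B -> (\int[mu]_(b in `]0%R, B]) (gJ b)%:E < +oo)%E.
  move=> B0; pose M := normal_peak s + normal_peak s.
  have gJM b : ((gJ b)%:E <= M%:E * nu setT)%E.
    rewrite gJE -integral_cst//; apply: ge0_le_integral => //.
    - by apply/measurable_EFinP; exact: measurable_folded_pdf_shift.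
    - by move=> y _; rewrite lee_fin; exact: folded_pdf_ub.
  apply: (@le_lt_trans _ _ (\int[mu]_(b in `]0%R, B]) (M%:E * nu setT))%E).
    apply: ge0_le_integral => //.
    - by move=> b _; rewrite gJE; exact: integral_ge0.
    - exact: measurable_funTS.
  have nuT : nu setT \is a fin_num by exact: fin_num_measure.
  rewrite -(fineK nuT) -EFinM integral_cst//= lebesgue_measure_itv/= lte_fin.
  by case: ifP => _; rewrite ?mule0 ?ltry// -EFinB -EFinM ltry.
have gJ0 b : 0 <= gJ b by rewrite -lee_fin gJE; exact: integral_ge0.
have gD0 b : 0 <= gD b by rewrite ltW// folded_pdf_gt0.
have igJ (B : R) : 0 <= B -> mu.-integrable `]0, B] (EFin \o gJ).
  move=> B0; apply/integrableP; split; first exact: measurable_funTS.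
  under eq_integral do rewrite /= ger0_norm//.
  exact: tfin.
have igD (B : R) : 0 <= B -> mu.-integrable `]0, B] (EFin \o gD).
  move=> B0; apply/integrableP; split.
    by apply/measurable_EFinP; apply: measurable_funTS; exact: measurable_folded_pdf.
  under eq_integral do rewrite /= ger0_norm//.
  rewrite -(normal_prob_folded s0 m B0); apply: le_lt_trans (le1 _ _) _.
  exact: ltry.
(* The constant term is L(0) = q, since the normal laws have no atom at 0. *)
apply: (@unique_minimum_of_monotone_ratio _ gD gJ L q q w) => //.
- by move=> b b0; exact: folded_pdf_gt0.
- exact: (mixture_ratio_increasing s0 m0 ms mA0 HA0 nuA0).
- exact: (mixture_ratio_unbounded s0 m0 ms mA0 HA0 nuA0).
move=> B B0; rewrite LE// -tonelli//.
have -> : normal_prob 0 s [set x | B < `|m + x|] =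
    (1 - normal_prob 0 s [set x | (`|m + x| <= B)%R])%E.
  rewrite -(probability_setC (normal_prob 0 s) (mS m B)); congr (normal_prob 0 s _).
  by apply/seteqP; split => x /=; rewrite ltNge => /negP.
have pfin : normal_prob 0 s [set x | `|m + x| <= B] \is a fin_num.
  by apply: fin_num_measure; exact: mS.
have gDE : fine (normal_prob 0 s [set x | `|m + x| <= B]) =
    \int[mu]_(b in `]0, B]) gD b by rewrite (normal_prob_folded s0 m B0).
by rewrite fineB// gDE mulrBr mulr1 addrAC.
Qed.

End threshold.

(** * Small time increments *)

Section small_time.
Context {R : realType}.
Local Notation mu := (@lebesgue_measure R).

(** In terms of x = sqrt h, s lies between sl x and su x while m is at most gu x^2. The last
    inequality then opposes order x^2 to order x, and each condition becomes an upper bound on x. *)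
Lemma small_time_bounds (gu sl su K c del : R) :
  0 < gu -> 0 < sl -> 0 < su -> 0 < K -> 0 < c -> 0 < del ->
  exists h0 : R, [/\ 0 < h0, h0 <= 1 & forall h s m,
    0 < h <= h0 -> 0 <= m <= gu * h -> 0 < s ->
    sl ^+ 2 * h <= s ^+ 2 <= su ^+ 2 * h ->
    [/\ 3 * m <= s, 3 * s <= del &
      (2 * m / (s - m)) ^+ 2 * K < expR (- 2) * (c * s)]].
Proof.
move=> gu0 sl0 su0 K0 c0 del0.
have e0 : 0 < expR (- 2) :> R by exact: expR_gt0.
(* The positive solution x of (3 gu x / sl)^2 K = exp(- 2) c sl x. *)
pose x1 := expR (- 2) * c * sl ^+ 3 / (9 * gu ^+ 2 * K).
have x10 : 0 < x1.
  by apply: divr_gt0; apply: mulr_gt0 => //; [exact: mulr_gt0|exact: exprn_gt0|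
    apply: mulr_gt0 => //; exact: exprn_gt0].
(* In this order: h_0 <= 1, then 3 m <= s, then 3 s <= del, then the last inequality, where halving
   [x1] makes it strict. *)
pose x0 := Num.min (Num.min 1 (sl / (3 * gu))) (Num.min (del / (3 * su)) (x1 / 2)).
have x00 : 0 < x0.
  rewrite !lt_min ltr01/=; apply/and3P; split; apply: divr_gt0 => //;
    exact: mulr_gt0.
exists (x0 ^+ 2); split; first exact: exprn_gt0.
  rewrite exprn_ile1//; first exact: ltW.
  by rewrite !ge_min lexx.
move=> h s m /andP[h0 hx] /andP[m0 mh] s0 /andP[slh suh].
pose x := Num.sqrt h.
have xh : x ^+ 2 = h by rewrite sqr_sqrtr// ltW.
have xgt0 : 0 < x by rewrite sqrtr_gt0.
have xx0 : x <= x0 by rewrite -ler_sqr ?nnegrE ?xh// ltW.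
have [xa xb xc] : [/\ x <= sl / (3 * gu), x <= del / (3 * su) & x <= x1 / 2].
  by move: xx0; rewrite !le_min => /andP[/andP[_ ->] /andP[-> ->]].
have slx : sl * x <= s.
  by rewrite -ler_sqr ?nnegrE ?mulr_ge0 ?(ltW s0) ?(ltW sl0) ?(ltW xgt0)// exprMn xh.
have sux : s <= su * x.
  by rewrite -ler_sqr ?nnegrE ?mulr_ge0 ?(ltW s0) ?(ltW su0) ?(ltW xgt0)// exprMn xh.
have mx : m <= gu * x ^+ 2 by rewrite xh.
have ms : 3 * m <= s.
  apply: le_trans slx; apply: (@le_trans _ _ (3 * (gu * x ^+ 2))).
    by rewrite ler_pM2l.
  rewrite expr2 !mulrA ler_pM2r// mulrC -ler_pdivlMr//.
  by rewrite mulr_gt0.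
split=> //.
  apply: (@le_trans _ _ (3 * (su * x))); first by rewrite ler_pM2l.
  by rewrite mulrA mulrC -ler_pdivlMr// mulr_gt0.
have sm0 : 0 < s - m by lra.
(* The factor 3 comes from 2 s <= 3 (s - m), equivalent to 3 m <= s. *)
have th : 2 * m / (s - m) <= 3 * gu * x / sl.
  rewrite ler_pdivrMr// mulrAC ler_pdivlMr//.
  apply: (@le_trans _ _ (2 * (gu * x ^+ 2) * sl)).
    by rewrite ler_pM2r// ler_pM2l.
  rewrite (_ : _ * sl = 2 * gu * x * (sl * x)); last by ring.
  apply: (@le_trans _ _ (2 * gu * x * s)).
    by rewrite ler_pM2l// !mulr_gt0.
  rewrite [leLHS](_ : _ = gu * x * (2 * s)); last by ring.
  rewrite [leRHS](_ : _ = gu * x * (3 * (s - m))); last by ring.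
  rewrite ler_pM2l; [lra|exact: mulr_gt0].
have th0 : 0 <= 2 * m / (s - m) by apply: divr_ge0; [exact: mulr_ge0|exact: ltW].
apply: (@le_lt_trans _ _ ((3 * gu * x / sl) ^+ 2 * K)).
  by rewrite ler_pM2r// ler_sqr ?nnegrE// (le_trans th0).
apply: (@lt_le_trans _ _ (expR (- 2) * (c * (sl * x)))); last first.
  by rewrite ler_pM2l// ler_pM2l.
have xlt : x < x1 by apply: (le_lt_trans xc); lra.
have D : 0 < 9 * gu ^+ 2 * K by apply: mulr_gt0 => //; apply: mulr_gt0 => //; exact: exprn_gt0.
move: xlt; rewrite /x1 ltr_pdivlMr// => xlt.
rewrite (_ : _ * K = x / sl ^+ 2 * (x * (9 * gu ^+ 2 * K))); last first.
  by field; rewrite gt_eqF.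
rewrite (_ : expR _ * _ = x / sl ^+ 2 * (expR (- 2) * c * sl ^+ 3)); last first.
  by field; rewrite gt_eqF.
by rewrite ltr_pM2l// divr_gt0// exprn_gt0.
Qed.

Lemma at_right_half (f : R -> R) : f x @[x --> 0^'+] --> f 0 -> 0 < f 0 ->
  exists2 del : R, 0 < del & forall x, 0 < x <= del -> f 0 / 2 <= f x.
Proof.
move=> fcv f0; have f2 : 0 < f 0 / 2 by rewrite divr_gt0.
have /cvgrPdist_lt /(_ _ f2) [e /= e0 He] := fcv.
exists (e / 2); first by rewrite divr_gt0.
move=> x /andP[x0 xe].
have : `|f 0 - f x| < f 0 / 2.
  by apply: He => //=; rewrite sub0r normrN gtr0_norm//; lra.
rewrite ltr_norml => /andP[_]; lra.
Qed.

Lemma at_left_half (f : R -> R) : f x @[x --> 0^'-] --> f 0 -> 0 < f 0 ->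
  exists2 del : R, 0 < del & forall x, - del <= x < 0 -> f 0 / 2 <= f x.
Proof.
move=> fcv f0; have f2 : 0 < f 0 / 2 by rewrite divr_gt0.
have /cvgrPdist_lt /(_ _ f2) [e /= e0 He] := fcv.
exists (e / 2); first by rewrite divr_gt0.
move=> x /andP[xe x0].
have : `|f 0 - f x| < f 0 / 2.
  by apply: He => //=; rewrite sub0r normrN ltr0_norm//; lra.
rewrite ltr_norml => /andP[_]; lra.
Qed.

(** The set A0 is an interval of length s whose translate by m is [s, 2 s] if p > 0, and
    [- 2 s, - s] if p = 0, when all jumps are negative. The condition 3 s <= del keeps it where the
    relevant one-sided density is at least half its value at 0; on the negative side it reaches down
    to - (2 s + m). *)
Lemma jump_density_mass_near0 (p : R) (fp fm : R -> R) :
  jump_density_conditions p fp fm ->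
  exists c del : R, [/\ 0 < c, 0 < del &
    forall s m, 0 < s -> 0 <= m -> 3 * m <= s -> 3 * s <= del ->
    exists A0 : set R, [/\ measurable A0,
      forall y, A0 y -> s <= `|m + y| <= 2 * s &
      ((c * s)%:E <= \int[mu]_(x in A0) (jump_density p fp fm x)%:E)%E]].
Proof.
case=> /andP[p0 p1] fp0 fm0 _ _ mfp mfm _ _ cfp cfm fp00 fm00 _ _ _ _.
have lb (c a b : R) (f : R -> R) : 0 <= c -> a <= b -> measurable_fun `[a, b] f ->
    (forall x, a <= x <= b -> c <= f x) ->
    ((c * (b - a))%:E <= \int[mu]_(x in `[a, b]) (f x)%:E)%E.
  move=> c0 ab mf cf.
  apply: (@le_trans _ _ (\int[mu]_(x in `[a, b]) c%:E)%E).
    rewrite integral_cst//= lebesgue_measure_itv/= lte_fin.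
    case: ifPn => [_|]; first by rewrite -EFinB -EFinM.
    rewrite -leNgt mule0 => ba; have -> : a = b by apply/eqP; rewrite eq_le ab.
    by rewrite subrr mulr0.
  apply: ge0_le_integral => //; exact/measurable_EFinP.
have fpE x : 0 <= x -> jump_density p fp fm x = p * fp x.
  move=> x0; rewrite /jump_density !indicE mem_set/=; last by rewrite in_itv/= x0.
  by rewrite memNset/= ?in_itv/= ?ltNge ?x0// mulr1 mulr0 addr0.
have fmE x : x < 0 -> jump_density p fp fm x = (1 - p) * fm x.
  move=> x0; rewrite /jump_density !indicE memNset/=; last by rewrite in_itv/= andbT leNgt x0.
  by rewrite mem_set/= ?in_itv/= ?x0// mulr1 mulr0 add0r.
have [pgt0|ple0] := ltP 0 p.
  have [del del0 Hdel] := at_right_half cfp fp00.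
  exists (p * (fp 0 / 2)), del; split => //; first by rewrite mulr_gt0// divr_gt0.
  move=> s m s0 m0 ms sdel.
  have [a0 ab bdel] : [/\ 0 < s - m, s - m <= 2 * s - m & 2 * s - m <= del].
    by split; lra.
  exists `[s - m, 2 * s - m]%classic; split => // [y|].
    rewrite /= in_itv/= => /andP[y1 y2]; rewrite ger0_norm; last by lra.
    by apply/andP; split; lra.
  have sE : s = 2 * s - m - (s - m) by ring.
  rewrite [in X in (X <= _)%E]sE.
  move: (s - m) (2 * s - m) a0 ab bdel {sE} => a b a0 ab bdel; apply: lb => //.
  - by rewrite mulr_ge0// divr_ge0// ltW.
  - apply: (@eq_measurable_fun _ _ _ _ _ (fun x => p * fp x)).
      by move=> x; rewrite inE/= in_itv/= => /andP[ax _]; rewrite fpE// (le_trans (ltW a0)).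
    apply: measurable_funM => //; apply: measurable_funS mfp => // x /=.
    by rewrite !in_itv/= => /andP[ax _]; rewrite andbT (le_trans (ltW a0)).
  - move=> x /andP[ax xb]; rewrite fpE ?(le_trans (ltW a0))// ler_pM2l//.
    by apply: Hdel; rewrite (lt_le_trans a0)// (le_trans xb).
have pE : p = 0 by apply/eqP; rewrite eq_le p0 ple0.
have [del del0 Hdel] := at_left_half cfm fm00.
exists (fm 0 / 2), del; split => //; first by rewrite divr_gt0.
move=> s m s0 m0 ms sdel.
have [a0 ab b0] : [/\ - del <= - (2 * s) - m, - (2 * s) - m <= - s - m & - s - m < 0].
  by split; lra.
exists `[- (2 * s) - m, - s - m]%classic; split => // [y|].
  rewrite /= in_itv/= => /andP[y1 y2]; rewrite ler0_norm; last by lra.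
  by apply/andP; split; lra.
have sE : s = - s - m - (- (2 * s) - m) by ring.
rewrite [in X in (X <= _)%E]sE.
move: (- (2 * s) - m) (- s - m) a0 ab b0 {sE} => a b a0 ab b0; apply: lb => //.
- by rewrite divr_ge0// ltW.
- apply: (@eq_measurable_fun _ _ _ _ _ fm).
    by move=> x; rewrite inE/= in_itv/= => /andP[_ xb]; rewrite fmE ?pE ?subr0 ?mul1r// (le_lt_trans xb).
  apply: measurable_funS mfm => // x /=.
  by rewrite !in_itv/= => /andP[_ xb]; rewrite (le_trans xb)// ltW.
- move=> x /andP[ax xb]; rewrite fmE ?pE ?subr0 ?mul1r ?(le_lt_trans xb)//.
  by apply: Hdel; rewrite (le_trans a0 ax) (le_lt_trans xb).
Qed.

End small_time.

(** * The jump-diffusion over a small time step *)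

Theorem theorem2p1 (R : realType) (d : measure_display)
    (Omega : measurableType d) (P : probability Omega R)
    (gamma sigma lambda : R -> R) (p : R) (fp fm : R -> R)
    (W : R -> {RV P >-> R}) (N : R -> {RV P >-> nat})
    (zeta : nat -> {RV P >-> R}) (S : R -> {RV P >-> R})
    (Hcoef : coefficient_conditions gamma sigma lambda)
    (Hdens : jump_density_conditions p fp fm)
    (HW : wiener_process W)
    (HN : poisson_process lambda N)
    (Hzeta : iid_with_density (jump_density p fp fm) zeta)
    (Hindep : independent_drivers W N zeta)
    (HS : wiener_integral_process W sigma S) :
  forall T : R, 0 < T ->
    exists2 h0 : R, 0 < h0 &
      forall t h w : R, 0 <= t <= T -> 0 < h <= h0 -> 0 < w ->
        let L := threshold_loss P (jump_diffusion gamma S N zeta) N t h w in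
        quasi_convex_on `[0, +oo[ L /\
        exists! B : R, global_min_on `[0, +oo[ L B.
Proof.
move=> T T0; have T10 : 0 < T + 1 by rewrite addr_gt0.
(* The coefficients are bounded on [0, T + 1], which contains [t, t + h] because h_0 <= 1. *)
have [gl [gu [gl0 Hg]]] := locally_bounded_away_bounds (gamma_bounded_away Hcoef) T10.
have [sl [su [sl0 Hsg]]] := locally_bounded_away_bounds (sigma_bounded_away Hcoef) T10.
have [ll [lu [ll0 Hl]]] := locally_bounded_away_bounds (lambda_bounded_away Hcoef) T10.
have T00 : 0 <= (0 : R) <= T + 1 by rewrite lexx ltW.
have gu0 : 0 < gu by have /andP[a b] := Hg _ T00; lra.
have su0 : 0 < su by have /andP[a b] := Hsg _ T00; lra.
have [c [del [c0 del0 Hd]]] := jump_density_mass_near0 Hdens.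
(* [expR lu] will bound the ratio of the probability of at least one jump to that of exactly one. *)
have [h0 [h00 h01 Hh]] := small_time_bounds gu0 sl0 su0 (expR_gt0 lu) c0 del0.
exists h0 => // t h w /andP[t0 tT] /andP[hpos hle] w0 L.
have th0 : 0 <= t + h by rewrite addr_ge0// ltW.
have th1 : t + h <= T + 1 by lra.
have tth : t <= t + h by lra.
have sub x : t <= x <= t + h -> 0 <= x <= T + 1 by move=> /andP[a b]; lra.
pose mu := @lebesgue_measure R.
have intS (g : R -> R) : locally_integrable_on_time g ->
    mu.-integrable `[t, t + h] (EFin \o g) /\ mu.-integrable `[0, t + h] (EFin \o g).
  move=> /(_ _ T10) ig; split; apply: integrableS ig => // x /=; rewrite !in_itv/=.
  by move=> /andP[-> /le_trans]; exact.
pose m := (\int[mu]_(u in `[0, t + h]) gamma u) - \int[mu]_(u in `[0, t]) gamma u.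
have [ig ig0] := intS _ (gamma_integrable Hcoef).
have mE : m = \int[mu]_(u in `[t, t + h]) gamma u.
  rewrite /m Rintegral_itvB ?bnd_simp//.
  rewrite Rintegral_itv_obnd_cbnd//; apply: integrableS ig => // x /=.
  by rewrite !in_itv/= => /andP[/ltW -> ->].
have /andP[mlo mhi] : 0 <= m <= gu * h.
  have := Rintegral_itv_bounds tth ig (fun x hx => Hg x (sub x hx)).
  rewrite -mE (_ : t + h - t = h); last by ring.
  by move=> /andP[a ->]; rewrite andbT (le_trans _ a)// mulr_ge0 ?ltW.
pose Lam := \int[mu]_(u in `[t, t + h]) lambda u.
have [il _] := intS _ (lambda_integrable Hcoef).
have /andP[Lamlo Lamhi] : ll * h <= Lam <= lu * h.
  have := Rintegral_itv_bounds tth il (fun x hx => Hl x (sub x hx)).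
  by rewrite (_ : t + h - t = h); last by ring.
have Lam0 : 0 < Lam by apply: lt_le_trans Lamlo; exact: mulr_gt0.
have Lamlu : Lam <= lu.
  apply: (le_trans Lamhi); rewrite ler_piMr//; last exact: le_trans h01.
  by have /andP[a b] := Hl _ T00; lra.
have msg : measurable_fun `[0, t + h] sigma.
  apply: (measurable_funS (measurable_itv `[0, +oo[)) => [x /=|].
    by rewrite !in_itv/= => /andP[->].
  apply: subspace_continuous_measurable_fun => //; exact: (sigma_continuous Hcoef).
have Hsg' u : 0 <= u <= t + h -> sl <= sigma u <= su.
  by move=> /andP[a b]; apply: Hsg; rewrite a (le_trans b).
have [v [vl vu Hv]] := wiener_integral_increment_law HW t0 hpos msg sl0 Hsg'
  (measurable_funP (S t)) (measurable_funP (S (t + h)))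
  (wiener_integral_process_at HS t0) (wiener_integral_process_at HS th0).
pose D om := S (t + h) om - S t om.
have mD : measurable_fun [set: Omega] D by exact: measurable_funB.
have v0 : 0 < v by apply: lt_le_trans vl; rewrite mulr_gt0// exprn_gt0.
pose s := Num.sqrt v.
have s0 : 0 < s by rewrite sqrtr_gt0.
have sv : s ^+ 2 = v by rewrite sqr_sqrtr// ltW.
have [ms s3 nuineq] : [/\ 3 * m <= s, 3 * s <= del &
    (2 * m / (s - m)) ^+ 2 * expR lu < expR (- 2) * (c * s)].
  by apply: (Hh h) => //; rewrite ?hpos ?mlo ?mhi// sv vl vu.
pose inc om : R := (N (t + h) om)%:R - (N t om)%:R.
pose E0 := [set om | inc om = 0].
pose E1 := [set om | inc om = 1].
pose En := [set om | inc om <> 0].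
have mE0 : measurable E0 by exact: measurable_jump_count.
have mE1 : measurable E1 by exact: measurable_jump_count.
have EnC : En = ~` E0 by [].
have mEn : measurable En by rewrite EnC; exact: measurableC.
have tlt : t < t + h by rewrite ltrDl.
have PE0 : P E0 = (expR (- Lam))%:E.
  have := poisson_increments_law HN t0 tlt 0.
  by rewrite /poisson_pmf -/Lam Lam0 expr0 fact0 invr1 !mul1r.
have PE1 : P E1 = (Lam * expR (- Lam))%:E.
  have := poisson_increments_law HN t0 tlt 1.
  by rewrite /poisson_pmf -/Lam Lam0 expr1 invr1 mulr1.
have PEn : (P En <= (expR lu * (Lam * expR (- Lam)))%:E)%E.
  rewrite EnC probability_setC// PE0 -EFinB lee_fin.
  (* 1 - exp(- Lam) <= Lam = exp(Lam) (Lam exp(- Lam)), and Lam <= lu. *)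
  apply: (@le_trans _ _ Lam); first by have := expR_ge1Dx (- Lam); lra.
  rewrite mulrCA -expRD ler_peMr ?(ltW Lam0)//.
  by rewrite -expR0 ler_expR subr_ge0.
pose J om := jump_part N zeta (t + h) om - jump_part N zeta t om.
have mJ : measurable_fun [set: Omega] J.
  by apply: measurable_funB; exact: measurable_jump_part.
pose nu : {finite_measure set R -> \bar R} := image_measure P mEn mJ.
have [A0 [mA0 HA0 zA0]] := Hd s m s0 mlo ms s3.
pose k := fine (P (zeta 0%N @^-1` A0)).
have mzeta j : measurable (zeta j @^-1` A0).
  by rewrite -[X in measurable X]setTI; exact: measurable_funP.
have kE j : P (zeta j @^-1` A0) = k%:E.
  rewrite /k fineK ?fin_num_measure//.
  by rewrite !(iid_density Hzeta).
have ck : c * s <= k by rewrite -lee_fin -(kE 0%N) (iid_density Hzeta).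
have nuA0 : (2 * m / (s - m)) ^+ 2 * fine (nu setT) < expR (- 2) * fine (nu A0).
  pose P1 := Lam * expR (- Lam).
  have P10 : 0 < P1 by rewrite mulr_gt0 ?expR_gt0.
  have nuT : fine (nu setT) <= expR lu * P1.
    have nuTE : nu setT = P En by rewrite /nu /= /image_measure preimage_setT setTI.
    by rewrite -lee_fin fineK ?fin_num_measure// nuTE.
  (* Only the event of exactly one jump is kept; there the jump sum has density f. *)
  have nuA : k * P1 <= fine (nu A0).
    rewrite -lee_fin fineK ?fin_num_measure// EFinM -PE1.
    rewrite -(one_jump_law Hindep t0 th0 mA0 kE).
    have mJA : measurable (J @^-1` A0).
      by rewrite -[X in measurable X]setTI; exact: (mJ _ _ _).
    apply: le_measure; rewrite ?inE//; [exact: measurableI|exact: measurableI|].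
    move=> om [Jo /= io]; split => //=; rewrite /En/= /inc io; apply/eqP.
    exact: oner_neq0.
  apply: (@le_lt_trans _ _ ((2 * m / (s - m)) ^+ 2 * expR lu * P1)).
    by rewrite -[leRHS]mulrA ler_wpM2l ?sqr_ge0.
  apply: (@lt_le_trans _ _ (expR (- 2) * (c * s) * P1)); first by rewrite ltr_pM2r.
  rewrite -[leLHS]mulrA ler_pM2l ?expR_gt0//; apply: le_trans nuA.
  by rewrite ler_pM2r.
have XE om : jump_diffusion gamma S N zeta (t + h) om -
    jump_diffusion gamma S N zeta t om = m + J om + D om.
  by rewrite /jump_diffusion /continuous_part /m /J /D; ring.
have inc0 om : inc om = 0 -> J om = 0.
  by move=> /eqP; rewrite subr_eq0 eqr_nat /J /jump_part => /eqP ->; rewrite subrr.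
have mnorm (y B : R) : measurable [set x : R | `|y + x| <= B].
  rewrite -[X in measurable X]setTI.
  have : measurable_fun [set: R] (fun x : R => `|y + x|).
    by apply: measurableT_comp => //; exact: measurable_funD.
  move=> /(_ measurableT `]-oo, B]%classic) /(_ (measurable_itv _)).
  by congr measurable; apply/seteqP; split => x /=; rewrite in_itv.
apply: (@threshold_loss_unique_minimum _ s m (fine (P E0)) w nu A0) => //.
  exact: fine_ge0.
move=> B B0; rewrite /L /threshold_loss; congr (_ + w * _).
  pose A := [set x : R | B < `|m + x|].
  have mA : measurable A.
    rewrite (_ : A = ~` [set x : R | `|m + x| <= B]); first exact: measurableC.
    by apply/seteqP; split => x /=; rewrite /A/= ltNge => /negP.
  rewrite [X in P X](_ : _ = D @^-1` A `&` E0); last first.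
    apply/seteqP; split => om /= [a b]; split => //; move: a; rewrite XE inc0// addr0//.
  have indE0 B' : sigma_algebra_of_family `[0, +oo[ W B' ->
      P (B' `&` E0) = (P B' * P E0)%E by exact: (no_jump_indep Hindep t0 th0).
  rewrite (Hv E0 mE0 indE0 A mA) fineM ?fin_num_measure// mulrC.
  by rewrite gauss_normal.
pose C : set (R * R) := [set z | `|m + z.1 + z.2| <= B].
have mC : measurable C.
  rewrite -[X in measurable X]setTI.
  have : measurable_fun [set: R * R] (fun z : R * R => `|m + z.1 + z.2|).
    apply: measurableT_comp => //; apply: measurable_funD; last exact: measurable_snd.
    by apply: measurable_funD => //; exact: measurable_fst.
  move=> /(_ measurableT `]-oo, B]%classic) /(_ (measurable_itv _)).
  by congr measurable; apply/seteqP; split => x /=; rewrite in_itv.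
(* The law of the diffusive increment is applied on the event that a jump occurs and [J] lies in
   [A1], which is independent of W. *)
have H (A1 A2 : set R) : measurable A1 -> measurable A2 ->
    P ((J @^-1` A1 `&` D @^-1` A2) `&` En) = (nu A1 * gauss v A2)%E.
  move=> mA1 mA2; rewrite (setIC (J @^-1` A1)) -setIA muleC.
  apply: (Hv (J @^-1` A1 `&` En)) => //.
    by apply: measurableI => //; rewrite -[X in measurable X]setTI; exact: (mJ _ _ _).
  by move=> B' HB'; exact: (jump_event_indep Hindep t0 th0 HB' mA1).
rewrite [X in P X](_ : _ = [set om | C (J om, D om)] `&` En); last first.
  by apply/seteqP; split => om /= [a b]; split => //; move: a; rewrite XE.
congr fine; apply: etrans (joint_law_of_rectangles mEn mJ mD H mC) _.
apply: eq_integral => y _.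
have -> : xsection C y = [set x | `|m + y + x| <= B].
  by apply/seteqP; split => x /=; rewrite /xsection/= inE.
exact: (gauss_normal v0 (mnorm _ _)).
Qed.
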